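(* For a composition $\alpha$ of $n$, there is a unique $H_n(0)$-module homomorphism $\Upsilon: \mathbf{Y}_\alpha \to \hat{\mathbf{S}}_{\alpha, C}$ such that $\Upsilon \circ \delta = \tilde{\eta} \circ \Gamma$ (as maps $\mathcal V_\alpha\to\hat{\mathbf S}_{\alpha,C}$).
   Context: Let $n$ be a nonnegative integer. $H_n(0)$ is the associative unital $\mathbb C$-algebra generated by $\pi_1,\dots,\pi_{n-1}$ with relations $\pi_i^2=\pi_i$, $\pi_i\pi_{i+1}\pi_i=\pi_{i+1}\pi_i\pi_{i+1}$, $\pi_i\pi_j=\pi_j\pi_i$ for $|i-j|\ge2$. A composition $\alpha=(\alpha_1,\dots,\alpha_l)$ of $n$ is a finite sequence of positive integers with sum $n$; $\alpha^{\mathrm r}=(\alpha_l,\dots,\alpha_1)$. Its composition diagram consists of left-justified rows with $\alpha_i$ cells in the $i$th row from the bottom; $(i,j)$ denotes the cell in the $i$th row from the bottom and $j$th column from the left. For a filling $T$ with $1,\dots,n$, $s_i\cdot T$ is obtained by swapping $i$ and $i+1$. Tableaux (all fillings of the composition diagram of $\alpha$ with $1,\dots,n$, each once, rows increasing from left to right): $\mathrm{SIT}(\alpha)$: first column increases from bottom to top. $\mathrm{SET}(\alpha)$: every column increases from bottom to top. $\mathrm{SYCT}(\alpha)$: first column increases from bottom to top and for cells $(i,k+1),(j,k)$ with $i<j$, if $T(i,k+1)\ge T(j,k)$ then $(j,k+1)$ is a cell and $T(i,k+1)>T(j,k+1)$. $\mathrm{SYCT}(\alpha;C)$: elements of $\mathrm{SYCT}(\alpha)$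 all of whose columns increase from bottom to top (so $\mathrm{SYCT}(\alpha;C)\subseteq\mathrm{SET}(\alpha)\subseteq\mathrm{SIT}(\alpha)$). Modules. $\mathcal V_\alpha=\mathbb C\,\mathrm{SIT}(\alpha)$ with $\pi_i\cdot\mathcal T=\mathcal T$ if $i$ is weakly above $i+1$; $0$ if $i,i+1$ are both in the first column (with $i$ below $i+1$); $s_i\cdot\mathcal T$ otherwise. $X_\alpha=\mathbb C\,\mathrm{SET}(\alpha)$ with $\pi_i\cdot T=T$ if $i$ is strictly left of $i+1$; $0$ if $i,i+1$ are in the same column; $s_i\cdot T$ if $i$ is strictly right of $i+1$. $\hat{\mathbf S}_{\alpha,C}=\mathbb C\,\mathrm{SYCT}(\alpha;C)$ with $\pi_i\cdot T=T$ if $i$ is strictly left of $i+1$; $\pi_i\cdot T=s_i\cdot T$ if $i$ is strictly right of $i+1$ and $s_i\cdot T\in\mathrm{SYCT}(\alpha;C)$; $0$ otherwise. Maps. $\Gamma:\mathcal V_\alpha\to X_\alpha$ is the linear map with $\Gamma(\mathcal T)=\mathcal T$ if $\mathcal T\in\mathrm{SET}(\alpha)$ and $0$ otherwise; $\tilde\eta:X_\alpha\to\hat{\mathbf S}_{\alpha,C}$ is the linear map with $\tilde\eta(T)=T$ if $T\in\mathrm{SYCT}(\alpha;C)$ and $0$ otherwise; both are known to be surjective $H_n(0)$-module homomorphisms. Insertion. Permutations are written as words; $w_0\in\mathfrak S_n$ is the longest element, so $\sigma w_0$ is the reversed word. A Young composition tableau is a filling of a composition diagram with positive integers whose rows weakly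 increase, whose first column strictly increases from bottom to top, and which satisfies the condition on cells $(i,k+1),(j,k)$ in the definition of $\mathrm{SYCT}$. For such $T$ and a positive integer $k$, define $k\to T$: list the cells $(c_1,d_1),(c_2,d_2),\dots$ of $T$ (before insertion) by decreasing column index $d$ and, within a column, decreasing row index $c$. Set $k_0:=k$ and process $i=1,2,\dots$: if $(c_i,d_i+1)$ is not a cell and $T(c_i,d_i)\le k_0$, place $k_0$ in a new cell $(c_i,d_i+1)$ and stop; if $(c_i,d_i+1)$ is a cell and $T(c_i,d_i)\le k_0<T(c_i,d_i+1)$, interchange $k_0$ with the entry in $(c_i,d_i+1)$ and continue; otherwise continue. If no stop occurs, create a new row with a single cell containing $k_0$, positioned so that the first column strictly increases from bottom to top. For $\sigma\in\mathfrak S_n$, $\hat{\mathsf P}(\sigma)$ is obtained from the empty tableau by inserting $\sigma(1),\dots,\sigma(n)$ successively. $\hat{\mathsf Q}(\sigma)$ is built simultaneously from the empty filling: at step $k$, if the new cell of $\hat{\mathsf P}$ lies in column $c=1$, add to $\hat{\mathsf Q}$ a new row with a single cell containing $k$, positioned so that the first column increases from bottom to top; if $c>1$, append $k$ at the end of the topmost row of $\hat{\mathsf Q}$ having exactly $c-1$ cells. $\mathbf Y_\alpha$ and $\delta$. $\mathcal T_\alpha$ is the filling of the composition diagram of $\alpha$ with $1,\dots,n$ from left to right in each row, starting with the bottommost row and going up. $\mathcal K_\alpha=\{\sigma\in\mathfrak S_n\mid\mathrm{sh}(\hat{\mathsf P}(\sigma w_0))=\alpha,\ \hat{\mathsf Q}(\sigma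 w_0)=\mathcal T_{\alpha^{\mathrm r}}\}$. $\mathrm{Des}_L(\sigma)=\{i\mid i\text{ is to the right of }i+1\text{ in the word of }\sigma\}$. $\mathbf Y_\alpha=\mathbb C\mathcal K_\alpha$ with $\pi_i\cdot\sigma=\sigma$ if $i\in\mathrm{Des}_L(\sigma)$; $s_i\sigma$ if $i\notin\mathrm{Des}_L(\sigma)$ and $s_i\sigma\in\mathcal K_\alpha$; $0$ otherwise. For a filling $T$, $\mathsf{w_r}(T)$ is the word obtained by reading each row from right to left, starting with the bottommost row and going up. $\delta:\mathcal V_\alpha\to\mathbf Y_\alpha$ is the surjective $H_n(0)$-module homomorphism with $\delta(\mathcal T)=\mathsf{w_r}(\mathcal T)$ if $\mathsf{w_r}(\mathcal T)\in\mathcal K_\alpha$ and $\delta(\mathcal T)=0$ otherwise, for $\mathcal T\in\mathrm{SIT}(\alpha)$. *)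

(* Defs.v *)
From HB Require Import structures.
From mathcomp Require Import all_boot all_order all_algebra.
From mathcomp Require Import reals complex.

Set Implicit Arguments.
Unset Strict Implicit.
Unset Printing Implicit Defensive.

Import GRing.Theory.

(* A filling of a composition diagram is the list of its rows, bottom row
    first, each row being read from left to right.  Rows and columns are
    numbered from 0, so the cell (i, j) of the French-style diagram, i, j >= 1,
    is [entry T i.-1 j.-1]; the letters themselves are 1, ..., n. *)

Definition is_composition (n : nat) (alpha : seq nat) : bool :=
  all (fun a => 0 < a) alpha && (sumn alpha == n).

Definition filling := seq (seq nat).

Definition trow (T : filling) (i : nat) : seq nat := nth [::] T i.
Definition is_cell (T : filling) (i j : nat) : bool := j < size (trow T i).
Definition entry (T : filling) (i j : nat) : nat := nth 0 (trow T i) j.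
Definition set_entry (T : filling) (i j x : nat) : filling :=
  set_nth [::] T i (set_nth 0 (trow T i) j x).

Definition row_of (x : nat) (T : filling) : nat := find (fun r => x \in r) T.
Definition col_of (x : nat) (T : filling) : nat := index x (trow T (row_of x T)).

Definition swap_letter (i x : nat) : nat :=
  if x == i then i.+1 else if x == i.+1 then i else x.
Definition s_word (i : nat) (w : seq nat) : seq nat := map (swap_letter i) w.
Definition s_fill (i : nat) (T : filling) : filling := map (s_word i) T.

Definition perm_words (n : nat) : seq (seq nat) := permutations (iota 1 n).

(* Fillings of the diagram of alpha with 1, ..., n, each used once; the
   characterization is [mem_fillings] below. *)
Definition fillings (alpha : seq nat) : seq filling :=
  map (reshape alpha) (perm_words (sumn alpha)).

Lemma mem_fillings (alpha : seq nat) (T : filling) :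
  (T \in fillings alpha) =
  (shape T == alpha) && perm_eq (flatten T) (iota 1 (sumn alpha)).
Proof.
apply/mapP/andP => [[w]|[/eqP <- pT]].
  rewrite mem_permutations => pw ->.
  have sw : size w = sumn alpha by rewrite (perm_size pw) size_iota.
  by rewrite reshapeKl ?reshapeKr ?sw.
by exists (flatten T); rewrite ?mem_permutations ?flattenK.
Qed.

Definition rows_increase (T : filling) : bool := all (sorted ltn) T.

Definition first_column_increases (T : filling) : bool :=
  sorted ltn (map (head 0) T).

(* The cells of one column need not lie in consecutive rows. *)
Definition columns_increase (T : filling) : bool :=
  all (fun j => all (fun i => all (fun k =>
    is_cell T i k ==> (entry T i k < entry T j k))
  (iota 0 (size (trow T j)))) (iota 0 j)) (iota 0 (size T)).

(* The condition on the cells (i, k+1) and (j, k), i < j, of a (standard)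
   Young composition tableau. *)
Definition triple_condition (T : filling) : bool :=
  all (fun j => all (fun i => all (fun k =>
    is_cell T i k.+1 && (entry T j k <= entry T i k.+1) ==>
    is_cell T j k.+1 && (entry T j k.+1 < entry T i k.+1))
  (iota 0 (size (trow T j)))) (iota 0 j)) (iota 0 (size T)).

Definition SIT (alpha : seq nat) : seq filling :=
  [seq T <- fillings alpha | rows_increase T && first_column_increases T].

Definition SET (alpha : seq nat) : seq filling :=
  [seq T <- fillings alpha | rows_increase T && columns_increase T].

Definition SYCT (alpha : seq nat) : seq filling :=
  [seq T <- fillings alpha |
    [&& rows_increase T, first_column_increases T & triple_condition T]].

Definition SYCT_C (alpha : seq nat) : seq filling :=
  [seq T <- SYCT alpha | columns_increase T].

(* A new row [:: k], placed so that the first column increases. *)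
Definition add_row (k : nat) (T : filling) : filling :=
  let p := find (fun r => k < head 0 r) T in
  take p T ++ [:: k] :: drop p T.

(* The cells by decreasing column, then by decreasing row. *)
Definition scan_order (T : filling) : seq (nat * nat) :=
  let width := foldr maxn 0 (shape T) in
  [seq cd <- [seq (c, d) | d <- rev (iota 0 width), c <- rev (iota 0 (size T))]
     | is_cell T cd.1 cd.2].

(* The second component of the result is the column of the new cell. *)
Fixpoint insert_along (cells : seq (nat * nat)) (k : nat) (T : filling) :
    filling * nat :=
  if cells is (c, d) :: cells' then
    if ~~ is_cell T c d.+1 then
      if entry T c d <= k then (set_entry T c d.+1 k, d.+1)
      else insert_along cells' k T
    else if (entry T c d <= k) && (k < entry T c d.+1) then
      insert_along cells' (entry T c d.+1) (set_entry T c d.+1 k)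
    else insert_along cells' k T
  else (add_row k T, 0).

Definition insert (k : nat) (T : filling) : filling * nat :=
  insert_along (scan_order T) k T.

(* Append k to the first row of length c in the list Q. *)
Fixpoint append_first (c k : nat) (Q : filling) : filling :=
  if Q is r :: Q' then
    if size r == c then rcons r k :: Q' else r :: append_first c k Q'
  else [::].

Definition append_topmost (c k : nat) (Q : filling) : filling :=
  rev (append_first c k (rev Q)).

(* Column c, counted from 0, is the (c+1)-st one: a letter recorded there is
   appended to a row having exactly c cells. *)
Definition record_step (c k : nat) (Q : filling) : filling :=
  if c == 0 then add_row k Q else append_topmost c k Q.

Definition PQ_step (PQ : filling * filling) (kx : nat * nat) :
    filling * filling :=
  let Pc := insert kx.2 PQ.1 in (Pc.1, record_step Pc.2 kx.1 PQ.2).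

Definition PQ (w : seq nat) : filling * filling :=
  foldl PQ_step ([::], [::]) (zip (iota 1 (size w)) w).

Definition P_hat (w : seq nat) : filling := (PQ w).1.
Definition Q_hat (w : seq nat) : filling := (PQ w).2.

Definition T_row (alpha : seq nat) : filling :=
  reshape alpha (iota 1 (sumn alpha)).

(* [rev w] is the word of w w_0. *)
Definition K_set (alpha : seq nat) : seq (seq nat) :=
  [seq w <- perm_words (sumn alpha) |
    (shape (P_hat (rev w)) == alpha) && (Q_hat (rev w) == T_row (rev alpha))].

Definition in_Des_L (i : nat) (w : seq nat) : bool := index i.+1 w < index i w.

Definition w_r (T : filling) : seq nat := flatten (map rev T).

(* [free_on C s] is the vector space with basis the finite set s.  All the
    maps considered send a basis element to a basis element or to 0; they are
    described by functions to an option type, where [None] stands for 0.  A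
    value outside the target basis would also count as 0, but this never
    happens: [SIT] and [SET] are stable under [V_act] and [X_act], and in the
    other cases membership is tested explicitly. *)

Local Open Scope ring_scope.

Section Free.
Variables (C : fieldType) (A B : choiceType).

Definition free_on (s : seq A) := {ffun seq_sub s -> C^o}.

Definition basis_vect (s : seq A) (o : option A) : free_on s :=
  [ffun x => (o == Some (ssval x))%:R].

Definition lin_map_fun (s : seq A) (t : seq B) (f : A -> option B)
    (v : {ffun seq_sub s -> C^o}) : {ffun seq_sub t -> C^o} :=
  [ffun y => \sum_(x : seq_sub s) v x * (f (ssval x) == Some (ssval y))%:R].

End Free.

Arguments basis_vect C {A} s o.

Definition lin_map (C : fieldType) (A B : choiceType) (s : seq A) (t : seq B)
    (f : A -> option B) : 'Hom(free_on C s, free_on C t) :=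
  linfun (lin_map_fun t f).

Arguments lin_map C {A B} s t f.

Lemma lin_map_fun_linear (C : fieldType) (A B : choiceType) (s : seq A)
  (t : seq B) (f : A -> option B) :
  linear (lin_map_fun (C := C) (s := s) t f).
Proof.
move=> a u v; apply/ffunP=> y; rewrite !ffunE scaler_sumr -big_split /=.
by apply: eq_bigr => x _; rewrite !ffunE mulrDl -scalerAl.
Qed.

Lemma lin_map_basis (C : fieldType) (A B : choiceType) (s : seq A)
  (t : seq B) (f : A -> option B) (x : A) : x \in s ->
  lin_map C s t f (basis_vect C s (Some x)) = basis_vect C t (f x).
Proof.
move=> xs.
have L := GRing.isLinear.Build _ _ _ _ _
  (lin_map_fun_linear (C := C) (s := s) t f).
pose l : {linear _ -> _} := HB.pack (lin_map_fun (C:=C) (s:=s) t f) L.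
rewrite /lin_map -[lin_map_fun _ _]/(l : _ -> _) lfunE /=.
apply/ffunP=> y; rewrite !ffunE (bigD1 (SeqSub xs)) //= !ffunE eqxx mul1r.
rewrite big1 ?addr0 // => z nz; rewrite !ffunE /=.
case: eqP => [[xz]|_]; last by rewrite mul0r.
by case/eqP: nz; apply/val_inj.
Qed.

Section Modules.
Variables (R : realType) (alpha : seq nat).

Definition V_mod := free_on R[i] (SIT alpha).
Definition X_mod := free_on R[i] (SET alpha).
Definition S_mod := free_on R[i] (SYCT_C alpha).
Definition Y_mod := free_on R[i] (K_set alpha).

Definition V_act (i : nat) (T : filling) : option filling :=
  if (row_of i.+1 T <= row_of i T)%N then Some T
  else if (col_of i T == 0)%N && (col_of i.+1 T == 0)%N then None
  else Some (s_fill i T).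

Definition X_act (i : nat) (T : filling) : option filling :=
  if (col_of i T < col_of i.+1 T)%N then Some T
  else if col_of i T == col_of i.+1 T then None
  else Some (s_fill i T).

Definition S_act (i : nat) (T : filling) : option filling :=
  if (col_of i T < col_of i.+1 T)%N then Some T
  else if (col_of i.+1 T < col_of i T)%N && (s_fill i T \in SYCT_C alpha)
  then Some (s_fill i T)
  else None.

Definition Y_act (i : nat) (w : seq nat) : option (seq nat) :=
  if in_Des_L i w then Some w
  else if s_word i w \in K_set alpha then Some (s_word i w)
  else None.

Definition V_pi (i : nat) : 'End(V_mod) := lin_map R[i] _ _ (V_act i).
Definition X_pi (i : nat) : 'End(X_mod) := lin_map R[i] _ _ (X_act i).
Definition S_pi (i : nat) : 'End(S_mod) := lin_map R[i] _ _ (S_act i).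
Definition Y_pi (i : nat) : 'End(Y_mod) := lin_map R[i] _ _ (Y_act i).

Definition Gamma : 'Hom(V_mod, X_mod) :=
  lin_map R[i] _ _ (fun T => if T \in SET alpha then Some T else None).

Definition eta_tilde : 'Hom(X_mod, S_mod) :=
  lin_map R[i] _ _ (fun T => if T \in SYCT_C alpha then Some T else None).

Definition delta : 'Hom(V_mod, Y_mod) :=
  lin_map R[i] _ _
    (fun T => if w_r T \in K_set alpha then Some (w_r T) else None).

End Modules.

(* A module over H_n(0) amounts to a vector space with operators pi_1, ...,
   pi_(n-1) satisfying the defining relations, and since the pi_i generate
   H_n(0), an H_n(0)-homomorphism is a linear map commuting with them. *)
Definition is_H0_morphism (n : nat) (C : fieldType) (M N : vectType C)
    (piM : nat -> 'End(M)) (piN : nat -> 'End(N)) (f : 'Hom(M, N)) : Prop :=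
  forall i : nat, (0 < i < n)%N -> (f \o piM i = piN i \o f)%VF.

(* Main.v *)
(* A basis element sigma of Y_alpha is the word w_r(T) of a unique filling T of
   the diagram of alpha, and Upsilon must send it to T if T is in SYCT(alpha; C)
   and to 0 otherwise.

   Uniqueness requires delta to be surjective: each sigma in K_alpha is w_r(T)
   with T in SIT(alpha).  The recording tableau says in which columns the new
   cells appear, and in a Young composition tableau (this property is preserved
   by insertion) a new cell always ends the lowest row of its length.  Hence
   removing the cells of the last block of letters from the shape alpha removes
   its bottom row, so that each block starts a new bottom row, with a letter
   smaller than all the previous ones, and then lengthens this row; by the
   bumping lemma the block increases.

   Upsilon o delta = eta o Gamma holds because inserting the rows of T in
   SYCT(alpha; C) from top to bottom bumps nothing, so that w_r(T) is in
   K_alpha.  For H_n(0)-linearity, let i be strictly below i+1 in T.  Exchanging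
   them reverses none of the strict inequalities defining SYCT(alpha; C) except
   for two cells of one column, and conversely. *)

Require Import Defs.
From mathcomp Require Import all_boot all_order all_algebra.
From mathcomp Require Import reals complex.
From mathcomp Require Import zify.

Set Implicit Arguments.
Unset Strict Implicit.
Unset Printing Implicit Defensive.

(** * The path of the inserted letters *)

(** The scanning order of insertion on pairs (row, column): columns from right to left, each from
    top to bottom. *)
Definition before (p q : nat * nat) : bool :=
  (q.2 < p.2) || (q.2 == p.2) && (q.1 < p.1).

Lemma before_trans : transitive before.
Proof. by move=> [a b] [c d] [e f]; rewrite /before /=; lia. Qed.

Lemma before_irr : irreflexive before.
Proof. by move=> [a b]; rewrite /before /=; lia. Qed.

(** The enumeration of [scan_order] on a full rectangle, so that the list of positions does not
    depend on the tableau. *)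
Definition grid (m w : nat) : seq (nat * nat) :=
  [seq (c, d) | d <- rev (iota 0 w), c <- rev (iota 0 m)].

Lemma mem_grid m w p : (p \in grid m w) = (p.1 < m) && (p.2 < w).
Proof.
case: p => c d; apply/allpairsP/andP => [[[d' c'] /= [Hd Hc [-> ->]]]|/= [Hc Hd]].
  by move: Hd Hc; rewrite !mem_rev !mem_iota; lia.
by exists (d, c); rewrite /= !mem_rev !mem_iota.
Qed.

Lemma pairwise_grid m w : pairwise before (grid m w).
Proof.
elim: w => // w IHw; rewrite /grid -[w.+1]addn1 iotaD add0n rev_cat /=.
rewrite pairwise_cat -/(grid m w) IHw andbT; apply/andP; split.
  apply/allrelP => p q /mapP [c _ ->]; rewrite mem_grid /before /=; lia.
elim: m {IHw} => // m IHm; rewrite -[m.+1]addn1 iotaD add0n rev_cat /= IHm andbT.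
by apply/allP => q /mapP [c]; rewrite mem_rev mem_iota /before => Hc -> /=; lia.
Qed.

Section Carry.

(* [t c d] is the entry of the cell (c, d), or a value [N] larger than all
   letters if this cell is missing.  Placing a letter in a new cell is then the
   same as exchanging it with [N], which is never exchanged again, so that
   insertion passes one letter along all the positions of a large grid. *)
Variable t : nat -> nat -> nat.

Definition bumps (k : nat) (p : nat * nat) : bool :=
  (t p.1 p.2 <= k) && (k < t p.1 p.2.+1).

Definition pass (k : nat) (p : nat * nat) : nat :=
  if bumps k p then t p.1 p.2.+1 else k.

Lemma passE x c d :
  pass x (c, d) = if (t c d <= x) && (x < t c d.+1) then t c d.+1 else x.
Proof. by []. Qed.

Lemma pass_bump x c d : t c d <= x -> x < t c d.+1 -> pass x (c, d) = t c d.+1.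
Proof. by rewrite passE => -> ->. Qed.

Variables (k : nat) (G : seq (nat * nat)).

Definition carry (u : nat) : nat := foldl pass k (take u G).

(** An exchange at a position alters the cell on its right, whence the shift of column. Column 0
    stays the same: a new row is accounted for separately. *)
Definition ins_entry (c d : nat) : nat :=
  if d is d'.+1 then
    let x := carry (index (c, d') G) in
    if ((c, d') \in G) && bumps x (c, d') then x else t c d
  else t c d.

Lemma carryS p : p \in G -> carry (index p G).+1 = pass (carry (index p G)) p.
Proof.
move=> pG; rewrite /carry (take_nth p) ?index_mem //.
by rewrite foldl_rcons nth_index.
Qed.

Lemma carry0 : carry 0 = k.
Proof. by rewrite /carry take0. Qed.

Lemma carry_size : carry (size G) = foldl pass k G.
Proof. by rewrite /carry take_size. Qed.

Lemma carry_oversize u : size G <= u -> carry u = carry (size G).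
Proof. by move=> Gu; rewrite /carry !take_oversize. Qed.

Hypothesis pG : pairwise before G.

Lemma uniq_before : uniq G.
Proof. exact: pairwise_uniq before_irr pG. Qed.

Lemma index_before p q : p \in G -> q \in G ->
  (index p G < index q G) = before p q.
Proof.
move=> Gp Gq; have H a b : a \in G -> b \in G ->
    index a G < index b G -> before a b.
  move=> Ga Gb lt_ab; have := pG => /(pairwiseP a) /(_ (index a G) (index b G)).
  by rewrite !nth_index // !inE !index_mem => /(_ Ga Gb lt_ab).
apply/idP/idP => [|bpq]; first exact: H.
rewrite ltnNge leq_eqVlt; apply/negP => /orP [/eqP e|lt_qp].
  have : p = q by rewrite -(nth_index p Gp) -(nth_index p Gq) e.
  by move=> e'; rewrite e' before_irr in bpq.
by have := before_trans bpq (H _ _ Gq Gp lt_qp); rewrite before_irr.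
Qed.

Lemma carry_step u : carry u.+1 = carry u \/
  exists p, [/\ p \in G, index p G = u, bumps (carry u) p,
                carry u < carry u.+1 & carry u.+1 = t p.1 p.2.+1].
Proof.
case: (ltnP u (size G)) => uG; last by left; rewrite !carry_oversize // ltnW.
have Gp := mem_nth (0, 0) uG; have ip := index_uniq (0, 0) uG uniq_before.
have := carryS Gp; rewrite ip /pass; case: ifP => [b|_]; last by left.
move=> e; right; exists (nth (0, 0) G u); rewrite ip b e; split=> //.
by case/andP: b.
Qed.

Lemma carry_le u v : u <= v -> carry u <= carry v.
Proof.
apply: (@homo_leq _ carry leq) => // [|w]; first exact: leq_trans.
by case: (carry_step w) => [->|[p [_ _ _ /ltnW]]].
Qed.

(** A discrete intermediate value property: the carried letter grows only by exchanges, so one of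
    them takes it from below [x] to [x] or more. *)
Lemma carry_jump x u v : u <= v -> carry u < x -> x <= carry v ->
  exists p, [/\ p \in G, u <= index p G < v, bumps (carry (index p G)) p,
     carry (index p G) < x <= t p.1 p.2.+1
     & carry (index p G).+1 = t p.1 p.2.+1].
Proof.
elim: v => [|v IHv] Huv Hu Hv.
  by move: Huv Hu Hv; rewrite leqn0 => /eqP ->; rewrite ltnNge => /negbTE ->.
case: (leqP x (carry v)) => Hx.
  have uv : u <= v.
    by case: (leqP u v) => // /ltnW /carry_le; lia.
  by have [p [? ? ? ? ?]] := IHv uv Hu Hx; exists p; split=> //; lia.
case: (carry_step v) => [e|[p [Gp ip bp _ e]]]; first by rewrite e leqNgt Hx in Hv.
have uv : u <= v.
  case: (leqP u v) => // vu; have e' : u = v.+1 by lia.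
  by rewrite e' ltnNge Hv in Hu.
exists p; rewrite ip -e; split=> //; first by rewrite uv ltnSn.
by rewrite Hx Hv.
Qed.

Lemma carry_origin u : carry u = k \/
  exists p, [/\ p \in G, index p G < u, bumps (carry (index p G)) p
                & carry u = t p.1 p.2.+1].
Proof.
elim: u => [|u IHu]; first by left; rewrite carry0.
case: (carry_step u) => [->|[p [Gp ip bp _ e]]].
  case: IHu => [->|[p [Gp ip bp e]]]; [by left | right].
  by exists p; split=> //; lia.
by right; exists p; rewrite ip; split.
Qed.

Lemma carry_nobump : (forall c d, k < t c d) -> forall u, carry u = k.
Proof.
move=> tk; elim=> [|u IHu]; first by rewrite carry0.
case: (carry_step u) => [->//|[p [_ _]]]; rewrite IHu /bumps.
by rewrite leqNgt tk.
Qed.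

End Carry.

Lemma ins_entry_cons t k p G c d : pairwise before (p :: G) ->
  ins_entry t k (p :: G) c d =
  if d is d'.+1 then
    if (c, d') == p then (if bumps t k p then k else t c d)
    else ins_entry t (pass t k p) G c d
  else t c d.
Proof.
move=> /= /andP [pG _]; case: d => // d /=; rewrite /carry /= inE.
by rewrite eq_sym; case: (eqVneq p (c, d)) => //= ->.
Qed.

Lemma eq_carry t1 t2 k G u :
  (forall p, p \in G ->
     t1 p.1 p.2 = t2 p.1 p.2 /\ t1 p.1 p.2.+1 = t2 p.1 p.2.+1) ->
  carry t1 k G u = carry t2 k G u.
Proof.
rewrite /carry; elim: u k G => [|u IHu] k [|p G] //= H.
have [e1 e2] := H p (mem_head _ _); rewrite /pass /bumps e1 e2.
by apply: IHu => q Gq; apply: H; rewrite inE Gq orbT.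
Qed.

Lemma carry_top t N k G u : (forall c d, t c d <= N) -> N <= k ->
  carry t k G u = k.
Proof.
move=> tN Nk; rewrite /carry; elim: u G => [|u IHu] [|p G] //=.
by rewrite /pass /bumps [k < _]ltnNge !(leq_trans (tN _ _) Nk) IHu.
Qed.

(** * Comparison of the carried letter with the insertion algorithm *)

Section Letters.
Variable N : nat.
Implicit Types (T : filling) (k c d : nat).

(** Like [entry], but with the default [N] for missing cells, as wanted for the function [t]
    above. *)
Definition letter T c d : nat := nth N (trow T c) d.
Definition bounded T : bool := all (all (fun x => x < N)) T.

Lemma letter_lt T c d : bounded T -> (letter T c d < N) = is_cell T c d.
Proof.
move=> bT; rewrite /letter /is_cell; case: (ltnP d (size _)) => dT; last first.
  by rewrite nth_default ?ltnn.
have cT : c < size T.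
  by move: dT; rewrite /trow; case: (ltnP c (size T)) => // ?; rewrite nth_default.
by have /allP /(_ _ (mem_nth [::] cT)) /allP -> := bT; last exact: mem_nth.
Qed.

Lemma letter_le T c d : bounded T -> letter T c d <= N.
Proof.
move=> bT; case: (ltnP (letter T c d) N) => [/ltnW //|].
by rewrite leqNgt letter_lt // => h; rewrite /letter nth_default // leqNgt.
Qed.

Lemma letter_entry T c d : is_cell T c d -> letter T c d = entry T c d.
Proof. exact: set_nth_default. Qed.

Lemma eq_trow T T' c : bounded T -> bounded T' ->
  (forall d, letter T c d = letter T' c d) -> trow T c = trow T' c.
Proof.
move=> bT bT' e.
have H d : (d < size (trow T c)) = (d < size (trow T' c)).
  by have := letter_lt c d bT; rewrite e letter_lt.
have es : size (trow T c) = size (trow T' c).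
  by have := H (size (trow T c)); have := H (size (trow T' c)); lia.
by apply: (@eq_from_nth _ N) => // d _; apply: e.
Qed.

Lemma cell_row T c d : is_cell T c d -> c < size T.
Proof.
rewrite /is_cell /trow; case: (ltnP c (size T)) => // h.
by rewrite nth_default.
Qed.

Lemma nth_set_nth_le (s : seq nat) d k d' : d <= size s ->
  nth N (set_nth 0 s d k) d' = if d' == d then k else nth N s d'.
Proof.
by elim: s d d' => [|x s IHs] [|d] [|d'] //= => [_|/IHs ->//]; rewrite nth_nil.
Qed.

Lemma letter_set T c d k c' d' : c < size T -> d <= size (trow T c) ->
  letter (set_entry T c d k) c' d' =
  if (c' == c) && (d' == d) then k else letter T c' d'.
Proof.
move=> cT dT; rewrite /letter /set_entry {1}/trow nth_set_nth /=.
by case: eqP => //= ->; rewrite nth_set_nth_le.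
Qed.

Lemma size_set_entry T c d k : c < size T -> size (set_entry T c d k) = size T.
Proof. by move=> cT; rewrite size_set_nth; apply/maxn_idPr. Qed.

Lemma bounded_set T c d k : bounded T -> k < N -> c < size T ->
  d <= size (trow T c) -> bounded (set_entry T c d k).
Proof.
move=> bT kN cT dT; apply/(all_nthP [::]) => i; rewrite size_set_entry //.
rewrite /set_entry nth_set_nth /= => iT; case: eqP => _; last first.
  by have /allP := bT; apply; apply: mem_nth.
have {}bT : all (fun x => x < N) (trow T c).
  by have /allP := bT; apply; apply: mem_nth.
elim: (trow T c) d dT bT => [|x s IHs] [|d] //=; rewrite ?kN //.
  by move=> _ /andP [].
by move=> h /andP [-> /(IHs _ h) ->].
Qed.

(** [insert_along] rewrites the tableau as it goes, whereas [carry] reads the initial one. Both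
    agree because an exchange alters only the cell on the right of the current position, which no
    later position consults. A final letter [f] below [N] opens a new row; otherwise [p] is where a
    letter was put into a missing cell. *)
Lemma insert_alongP (P : pred (nat * nat)) G T k :
    pairwise before G -> bounded T -> k < N ->
    (forall p, p \in G -> P p = is_cell T p.1 p.2) ->
  let f := foldl (pass (letter T)) k G in
  exists T1, [/\ size T1 = size T, bounded T1,
    forall c d, letter T1 c d = ins_entry (letter T) k G c d &
    if f < N then insert_along (filter P G) k T = (add_row f T1, 0)
    else exists p, [/\ p \in G, letter T p.1 p.2.+1 = N,
           bumps (letter T) (carry (letter T) k G (index p G)) p &
           insert_along (filter P G) k T = (T1, p.2.+1)]].
Proof.
elim: G T k => [|p G IHG] T k pG bT kN HP /=.
  exists T; split=> //; last by rewrite kN.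
  by move=> c [].
have := pG => /= /andP [/allP pbG pG'].
have HP' q : q \in G -> P q = is_cell T q.1 q.2.
  by move=> Gq; apply: HP; rewrite inE Gq orbT.
have Pp := HP p (mem_head _ _).
(* Without an exchange, [p] is filtered out or leaves the letter in hand; for a missing right cell,
   of value [N > k], this means that the entry of [p] exceeds [k]. *)
have skip : bumps (letter T) k p = false ->
    insert_along (filter P (p :: G)) k T = insert_along (filter P G) k T.
  rewrite /bumps /= Pp; case: p {pG pbG HP Pp} => c d /=.
  case: ifP => [cd|//] /=; rewrite (letter_entry cd).
  case: (boolP (is_cell T c d.+1)) => [cd1|] /=; first by rewrite letter_entry // => ->.
  rewrite -letter_lt // -leqNgt => h; rewrite (leq_trans kN h) andbT.
  by move=> ->.
case: (boolP (bumps (letter T) k p)) => bp; last first.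
  rewrite skip ?(negbTE bp) //.
  have pk : pass (letter T) k p = k by rewrite /pass (negbTE bp).
  have [T1 [s1 b1 l1 res]] := IHG T k pG' bT kN HP'.
  rewrite pk; exists T1; split=> //.
    move=> c d; rewrite ins_entry_cons // pk (negbTE bp) l1.
    case: d => // d; case: eqP => // e; rewrite /= e.
    by case: (boolP (p \in G)) => // /pbG; rewrite before_irr.
  case: ifP res => // _ [q [Gq tq bq ->]]; exists q; split=> //.
    by rewrite inE Gq orbT.
  have /negbTE npq : p != q by apply: contraTneq (pbG q Gq) => ->; rewrite before_irr.
  by rewrite /= npq /carry /= pk.
have pk : pass (letter T) k p = letter T p.1 p.2.+1 by rewrite /pass bp.
case/andP: (bp) => b1 b2.
have cp : is_cell T p.1 p.2 by rewrite -letter_lt // (leq_ltn_trans b1).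
have rp := cell_row cp.
set T2 := set_entry T p.1 p.2.+1 k.
have b2' : bounded T2 by apply: bounded_set.
have l2 c d : letter T2 c d = if (c == p.1) && (d == p.2.+1) then k else letter T c d.
  by rewrite letter_set.
have agree q : q \in G -> letter T2 q.1 q.2 = letter T q.1 q.2 /\
     letter T2 q.1 q.2.+1 = letter T q.1 q.2.+1.
  move=> /pbG; case: (p) (q) l2 => [c d] [c' d'] /= l2; rewrite /before /= !l2.
  by split; case: ifP => //; lia.
have pnG : p \notin G by apply/negP => /pbG; rewrite before_irr.
have res : insert_along (filter P (p :: G)) k T =
   if is_cell T p.1 p.2.+1 then insert_along (filter P G) (letter T p.1 p.2.+1) T2
   else (T2, p.2.+1).
  rewrite /= Pp cp /T2; case: (p) b1 b2 cp => c d /= b1 b2 cp.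
  rewrite -(letter_entry cp) b1; case: ifP => [/negbTE -> //|/negbFE e].
  by rewrite e -(letter_entry e) b2.
rewrite res -letter_lt //; rewrite pk.
case: ifP => lN.
  have [|T1 [s1 b1' l1 res1]] := IHG T2 (letter T p.1 p.2.+1) pG' b2' lN.
    move=> q Gq; rewrite HP' // -!letter_lt //.
    by have [->] := agree q Gq.
  have ef : foldl (pass (letter T2)) (letter T p.1 p.2.+1) G =
            foldl (pass (letter T)) (letter T p.1 p.2.+1) G.
    by rewrite -!carry_size; apply: eq_carry.
  rewrite ef in res1; exists T1; split=> //.
  - by rewrite s1 size_set_entry.
  - move=> c d; rewrite ins_entry_cons // l1 bp pk.
    case: d => [|d] /=; first by rewrite l2 andbF.
    rewrite (eq_carry _ _ agree).
    case: (eqVneq (c, d) p) => [e|ne] /=.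
      by rewrite e (negbTE pnG) /= l2 -e !eqxx.
    rewrite l2; case: (boolP (_ && (d.+1 == _))) => [/andP [/eqP e1 /eqP [e2]]|_].
      by rewrite e1 e2 -surjective_pairing eqxx in ne.
    case: (boolP ((c, d) \in G)) => //= Gcd.
    by have [/= e1 e2] := agree _ Gcd; rewrite /bumps /= e1 e2.
  case: ifP res1 => // _ [q [Gq tq bq ->]]; exists q.
  have [e1 e2] := agree q Gq.
  have /negbTE npq : p != q by apply: contraNneq pnG => ->.
  split=> //; first by rewrite inE Gq orbT.
    by rewrite -e2.
  move: bq; rewrite (eq_carry _ _ agree) /bumps e1 e2.
  by rewrite /= npq /carry /= pk.
have eN : letter T p.1 p.2.+1 = N.
  by apply/eqP; rewrite eqn_leq letter_le // leqNgt lN.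
(* The letter found a missing cell: the carried value becomes [N], and [carry_top] freezes it for
   the rest of the path. *)
have tN c d : letter T c d <= N by apply: letter_le.
rewrite eN -carry_size (carry_top _ _ tN) // ltnn.
exists T2; split=> //.
- by rewrite size_set_entry.
- move=> c d; rewrite ins_entry_cons // bp pk eN l2.
  case: d => [|d]; first by rewrite andbC.
  rewrite /= (carry_top _ _ tN) // /bumps /= [N < _]ltnNge !tN /= andbF.
  by rewrite [in RHS](surjective_pairing p) xpair_eqE eqSS.
- by exists p; rewrite mem_head /= eqxx carry0.
Qed.
End Letters.

Lemma leq_foldr_maxn (s : seq nat) i : nth 0 s i <= foldr maxn 0 s.
Proof.
elim: s i => [|x s IHs] [|i] //=; first exact: leq_maxl.
exact: leq_trans (IHs i) (leq_maxr _ _).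
Qed.

(** Both lists are sorted for the strict order [before] and have the same elements. The free bound
    [M] lets two successive tableaux share one grid. *)
Lemma scan_orderE (T : filling) (M : nat) :
  (forall c d, is_cell T c d -> (c < M) && (d < M)) ->
  scan_order T = [seq p <- grid M M | is_cell T p.1 p.2].
Proof.
move=> TM; apply: (irr_sorted_eq before_trans before_irr).
- exact/(sorted_filter before_trans)/pairwise_sorted/pairwise_grid.
- exact/(sorted_filter before_trans)/pairwise_sorted/pairwise_grid.
move=> [c d]; rewrite !mem_filter -/(grid _ _) !mem_grid /=.
case: (boolP (is_cell T c d)) => Tcd //.
have rT := cell_row Tcd; rewrite (TM _ _ Tcd) rT /=.
apply: leq_trans Tcd _; apply: leq_trans (leq_foldr_maxn _ c).
by rewrite (nth_map [::]).
Qed.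

(** * Insertion into Young composition tableaux *)

Section Insertion.
Implicit Types c d i j e u x : nat.
Variables (N : nat) (t : nat -> nat -> nat).

(** Young composition tableaux as functions, [N] marking missing cells: an inequality [< N] asserts
    that a cell exists. Thus [yct_row] also makes the rows left-justified, and the conclusion of
    [yct_triple] provides the cell (j, d+1). *)
Record yct : Prop := Yct {
  yct_le : forall c d, t c d <= N;
  yct_row : forall c d, t c d <= t c d.+1;
  yct_col0 : forall i j, i < j -> t j 0 < N -> t i 0 < t j 0;
  yct_triple : forall i j d, i < j -> t i d.+1 < N -> t j d <= t i d.+1 ->
    t j d.+1 < t i d.+1;
  yct_inj : forall c d c' d', t c d = t c' d' -> t c d < N ->
    (c, d) = (c', d') }.

Hypothesis tY : yct.
Variables (k M : nat).
Hypotheses (kN : k < N) (kt : forall c d, t c d != k).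
(** The margin keeps in the grid the first missing position after each nonempty row too. *)
Hypothesis tM : forall c d, t c d < N -> (c.+1 < M) && (d.+1 < M).

Local Notation G := (grid M M).
Local Notation pG := (pairwise_grid M M).
(** The letter in hand on arrival at (c, d), before any exchange there. *)
Definition kap (c d : nat) : nat := carry t k G (index (c, d) G).
Definition final : nat := carry t k G (size G).
Local Notation t' := (ins_entry t k G).

Lemma cell_grid c d : t c d < N -> (c, d) \in G.
Proof. by move=> /tM; rewrite mem_grid /= => /andP [/ltnW -> /ltnW ->]. Qed.

Lemma kap_before c d c' d' : (c, d) \in G -> (c', d') \in G ->
  before (c, d) (c', d') -> pass t (kap c d) (c, d) <= kap c' d'.
Proof.
move=> Gp Gq b; rewrite /kap -(carryS _ _ Gp) //; apply: carry_le; first exact: pG.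
by rewrite index_before // pG.
Qed.

Lemma leq_pass x p : x <= pass t x p.
Proof. by rewrite /pass; case: ifP => // /andP [_ /ltnW]. Qed.

Lemma kap_le c d c' d' : (c, d) \in G -> (c', d') \in G ->
  ~~ before (c', d') (c, d) -> kap c d <= kap c' d'.
Proof.
move=> Gp Gq; rewrite -(index_before pG) // -leqNgt => h.
by apply: carry_le => //; exact: pG.
Qed.

Lemma kap_final c d : (c, d) \in G -> pass t (kap c d) (c, d) <= final.
Proof.
move=> Gp; rewrite /kap -(carryS _ _ Gp) //; apply: carry_le; first exact: pG.
by rewrite index_mem.
Qed.

Lemma kap_jump x c d c' d' : (c, d) \in G -> (c', d') \in G ->
  kap c d < x -> x <= kap c' d' -> ~~ before (c', d') (c, d) ->
  exists i e, [/\ ~~ before (i, e) (c, d), before (i, e) (c', d'),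
     t i e <= kap i e, kap i e < x & x <= t i e.+1 <= kap c' d'].
Proof.
move=> Gp Gq H1 H2 b.
have [|[i e] [Gr /andP [h1 h2] /andP [b1 b2] /andP [b3 b4] e5]] :=
  carry_jump pG _ H1 H2; first by rewrite leqNgt (index_before pG).
exists i, e; split=> //; first by rewrite -(index_before pG) // -leqNgt.
  by rewrite -(index_before pG).
rewrite b4 /=; rewrite -[t i e.+1]e5; apply: carry_le => //; exact: pG.
Qed.

Lemma kap_jump_final x c d : (c, d) \in G -> kap c d < x -> x <= final ->
  exists i e, [/\ ~~ before (i, e) (c, d),
     t i e <= kap i e, kap i e < x, x <= t i e.+1 & t i e.+1 <= final].
Proof.
move=> Gp H1 H2.
have [|[i e] [Gr /andP [h1 h2] /andP [b1 b2] /andP [b3 b4] e5]] :=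
  carry_jump pG _ H1 H2; first by rewrite index_size.
exists i, e; split=> //; first by rewrite -(index_before pG) // -leqNgt.
by rewrite -[t i e.+1]e5; apply: carry_le => //; exact: pG.
Qed.

(** Letters are distinct and [k] is new, so the letter of the cell (c, d+1) can only have been
    picked up by the exchange at (c, d). *)
Lemma carry_eq u c d : carry t k G u = t c d.+1 -> t c d.+1 < N ->
  [/\ (c, d) \in G, index (c, d) G < u & bumps t (kap c d) (c, d)].
Proof.
case: (carry_origin t k pG u) => [->|[[i e] [Gp iu b ->]]] /=.
  by move=> h; have := kt c d.+1; rewrite -h eqxx.
by move=> h tN; case: (yct_inj tY (esym h) tN) => -> ->.
Qed.

Lemma origin u : carry t k G u = k \/ exists i e,
  [/\ (i, e) \in G, t i e <= kap i e, kap i e < t i e.+1 &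
      carry t k G u = t i e.+1].
Proof.
case: (carry_origin t k pG u) => [->|[[i e] [Gp _ /andP [b1 b2] e']]].
  by left.
by right; exists i, e.
Qed.

Lemma ins_spec c d : 
  (exists e, [/\ d = e.+1, (c, e) \in G, t c e <= kap c e, kap c e < t c d &
     t' c d = kap c e]) \/
  [/\ t' c d = t c d & forall e, d = e.+1 -> (c, e) \in G ->
     t c e <= kap c e -> kap c e < t c d -> False].
Proof.
case: d => [|d]; first by right.
rewrite /=; case: (boolP ((c, d) \in G)) => Gp /=; last first.
  by right; split=> // e [<-] h; rewrite h in Gp.
rewrite /bumps /=; case: (boolP (_ && _)) => [/andP [h1 h2]|h].
  by left; exists d.
by right; split=> // e [<-] _ h1 h2; move: h; rewrite h1 h2.
Qed.

Lemma ins_le c d : t' c d <= t c d.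
Proof. by case: (ins_spec c d) => [[e [_ _ _ /ltnW h ->]]|[-> _]]. Qed.

Lemma ins_row c d : t' c d <= t' c d.+1.
Proof.
case: (ins_spec c d.+1) => [[e [[<-] _ h _ ->]]|[-> _]].
  exact: leq_trans (ins_le c d) h.
exact: leq_trans (ins_le c d) (yct_row tY c d).
Qed.

(* If the entry in (j, d) is replaced, it is by a letter carried after all of
   column d was visited; and if the carried letter passes from below to above
   some entry, it was exchanged in between.  The triple condition for [t] at
   the place of that exchange gives the conclusion. *)
Lemma ins_triple i j d : i < j -> t' i d.+1 < N -> t' j d <= t' i d.+1 ->
  t' j d.+1 < t' i d.+1.
Proof.
move=> ij; case: (ins_spec i d.+1) => [[? [[<-] Gi ai bi ->]]|[-> ni]] iN le_ij.
- have Gj : (j, d) \in G.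
    case: (ins_spec j d) => [[e' [ed _ h _ jd]]|[jd _]]; last first.
      by apply: cell_grid; rewrite -jd; apply: leq_ltn_trans iN.
    have := leq_ltn_trans (leq_trans h _) iN; rewrite -jd => /(_ le_ij) /tM.
    by rewrite mem_grid /= ed; lia.
  have ji : before (j, d) (i, d) by rewrite /before /=; lia.
  have jd : t j d <= kap i d.
    case: (ins_spec j d) le_ij => [[e' [ed Gj' _ _ ->]]|[-> //]].
    have : pass t (kap i d) (i, d) <= kap j e'.
      by apply: kap_before => //; rewrite /before /= ed; lia.
    by rewrite pass_bump //; lia.
  have x_le := kap_before Gj Gi ji.
  case: (ins_spec j d.+1) => [[? [[<-] _ aj bj ->]]|[-> nj]].
    by move: x_le; rewrite pass_bump //; lia.
  (* Carrying [t j d.+1] would mean that it was picked up at (j, d), which [nj] excludes. *)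
  have ne : kap i d = t j d.+1 -> False.
    move=> e; have [|_ _ /andP [h1 h2]] := carry_eq e; first by rewrite -e.
    exact: (nj d).
  have x_le' : kap j d <= kap i d by apply: leq_trans x_le; apply: leq_pass.
  case: (leqP (t j d) (kap j d)) => aj.
    case: (ltnP (kap j d) (t j d.+1)) => bj; first by case: (nj d).
    lia.
  have [|r [e [b1 b2 h1 h2 /andP [h3 h4]]]] := kap_jump Gj Gi aj jd.
    by rewrite /before /=; lia.
  have [er rj] : e = d /\ r <= j by move: b1 b2; rewrite /before /=; lia.
  rewrite er in b1 b2 h1 h2 h3 h4.
  case: (eqVneq r j) => [rj'|/eqP nrj]; first by rewrite rj' in h1 h2; lia.
  have : t j d.+1 < t r d.+1 by apply: (yct_triple tY) => //; lia.
  lia.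
- have Gi : (i, d) \in G.
    by apply: cell_grid; apply: leq_ltn_trans (yct_row tY _ _) iN.
  have tj : t j d <= t i d.+1 -> t' j d.+1 < t i d.+1.
    by move=> h; apply: leq_ltn_trans (ins_le _ _) _; apply: (yct_triple tY).
  case: (ins_spec j d) le_ij => [[e [ed Gj hz bz ->]]|[-> _]] le_ij; last exact: tj.
  subst d; case: (leqP (t j e.+1) (t i e.+2)) => [|lt_ij]; first exact: tj.
  exfalso.
  have yz : kap i e.+1 <= kap j e.
    by apply: kap_le => //; rewrite /before /=; lia.
  have ne : kap i e.+1 = t i e.+2 -> False.
    by move=> h; have [//|_] := carry_eq h; rewrite ltnn.
  have yai : kap i e.+1 < t i e.+1.
    by rewrite ltnNge; apply/negP => h; apply: (ni _ erefl Gi h); lia.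
  have aiz : t i e.+1 <= kap j e.
    case: (leqP (t j e) (t i e.+1)) => h; last lia.
    have : t j e.+1 < t i e.+1.
      by apply: (yct_triple tY) => //; apply: leq_ltn_trans (yct_row tY _ _) iN.
    by have := yct_row tY i e.+1; lia.
  have [|r [e' [b1 b2 h1 h2 /andP [h3 h4]]]] := kap_jump Gi Gj yai aiz.
    by rewrite /before /=; lia.
  have jN : t j e.+1 <= N by apply: yct_le.
  (* The letter passes [t i e.+1] at the position (r, e'). For [r = i] the bounds clash at once;
     otherwise the triple condition for [t] is contradicted. *)
  have [[e1 r1]|[e1 r1]] : (e' = e.+1 /\ r <= i) \/ (e' = e /\ j < r).
    by move: b1 b2; rewrite /before /=; lia.
    subst e'; case: (eqVneq r i) => [e2|/eqP nri]; first by subst r; lia.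
    have : t i e.+2 < t r e.+2 by apply: (yct_triple tY) => //; lia.
    lia.
  subst e'.
  have : t r e.+1 < t i e.+1 by apply: (yct_triple tY) => //; lia.
  lia.
Qed.

(** The triple condition when [final] starts a new row above row [i]: that row has no second cell,
    so the strict inequality is required. If the letter passes [t i 0] only after (i, 0), it does so
    by an exchange in a lower row, where the triple condition for [t] gives the bound. *)
Lemma ins_new_row i : t i 0 < final -> final < N -> t' i 1 < N ->
  t' i 1 < final.
Proof.
move=> h0 fN; case: (ins_spec i 1) => [[e [[<-] Gi ai bi ->]] _|[-> ni] iN].
  by have := kap_final Gi; rewrite pass_bump //; lia.
have Gi : (i, 0) \in G by apply: cell_grid; lia.
have ne : final = t i 1 -> False.
  by move=> h; have [//|_ _ /andP [h1 h2]] := carry_eq h; apply: (ni 0).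
rewrite ltnNge; apply/negP => h.
have yf : kap i 0 <= final by apply: leq_trans (kap_final Gi); apply: leq_pass.
have yai : kap i 0 < t i 0.
  by rewrite ltnNge; apply/negP => h'; apply: (ni _ erefl Gi h'); lia.
have [r [e [b1 h1 h2 h3 h4]]] := kap_jump_final Gi yai (ltnW h0).
have [e1 r1] : e = 0 /\ r <= i by move: b1; rewrite /before /=; lia.
subst e; case: (eqVneq r i) => [e2|/eqP nri]; first by subst r; lia.
have : t i 1 < t r 1 by apply: (yct_triple tY) => //; lia.
lia.
Qed.

Lemma ins_val c d : t' c d < N -> t' c d = k \/ exists i e, t' c d = t i e.
Proof.
case: (ins_spec c d) => [[e [_ Gp _ _ ->]]|[-> _]]; last by right; exists c, d.
case: (origin (index (c, e) G)) => [h|[i [e' [_ _ _ E]]]] _; first by left.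
by right; exists i, e'.+1; rewrite /kap E.
Qed.

Lemma final_val : final < N -> final = k \/ exists i e, final = t i e.
Proof.
case: (origin (size G)) => [h|[i [e' [_ _ _ E]]]] _; first by left.
by right; exists i, e'.+1; rewrite /final E.
Qed.

(** A carried letter has left its old cell, and the carried letter strictly grows at each exchange,
    so no letter is put down twice or both moved and kept. *)
Lemma ins_inj c d c' d' : t' c d = t' c' d' -> t' c d < N -> (c, d) = (c', d').
Proof.
have mixed c1 d1 c2 d2 e1 : (c1, e1) \in G -> kap c1 e1 = t c2 d2 ->
    t' c1 d1 = kap c1 e1 -> t' c2 d2 = t c2 d2 -> t c2 d2 < N -> False.
  move=> G1 e E1 E2 tN.
  case: (origin (index (c1, e1) G)) => [ek|[i [e' [Gi b1 b2 e'']]]].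
    by have := kt c2 d2; rewrite -e /kap ek eqxx.
  have [? ?] := yct_inj tY (etrans (esym e) e'') tN; subst c2 d2.
  by case: (ins_spec i e'.+1) => [[? [[<-] _ _ h E]]|[_ h]]; [lia | exact: (h e')].
have kap_inj c1 e1 c2 e2 : (c1, e1) \in G -> (c2, e2) \in G ->
    bumps t (kap c1 e1) (c1, e1) ->
    kap c1 e1 = kap c2 e2 -> ~~ before (c1, e1) (c2, e2).
  move=> G1 G2 b e; apply/negP => /(kap_before G1 G2).
  by rewrite /pass b -e; case/andP: b => _ /=; lia.
case: (ins_spec c d) => [[e [-> Gp a b E]]|[E ne]];
case: (ins_spec c' d') => [[e' [-> Gp' a' b' E']]|[E' ne']].
- rewrite E E' => h _.
  have [e1 e2] : c = c' /\ e = e'.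
    have := kap_inj _ _ _ _ Gp Gp'; have := kap_inj _ _ _ _ Gp' Gp.
    rewrite -h /bumps /= a b.
    have -> : t c' e' <= kap c e by rewrite h.
    have -> : kap c e < t c' e'.+1 by rewrite h.
    by rewrite /before /=; move=> /(_ isT erefl) + /(_ isT erefl); lia.
  by rewrite e1 e2.
- rewrite {1}E E' => h; rewrite E => tN; exfalso.
  by apply: (mixed _ _ _ _ _ Gp h E E'); rewrite -h.
- rewrite {1}E E' => h; rewrite E => tN; exfalso.
  by apply: (mixed _ _ _ _ _ Gp' (esym h) E' E).
- by rewrite E E' => h tN; apply: (yct_inj tY).
Qed.

Lemma final_fresh c d : final < N -> t' c d = final -> False.
Proof.
move=> fN; case: (ins_spec c d) => [[e [-> Gp a b E]]|[E ne]]; rewrite E => h.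
  by have := kap_final Gp; rewrite pass_bump //; lia.
case: (origin (size G)) => [ek|[i [e' [Gi b1 b2 e'']]]].
  by have := kt c d; rewrite h /final ek eqxx.
have hN : t c d < N by rewrite h.
have [? ?] := yct_inj tY (etrans h e'') hN; subst c d.
exact: (ne e').
Qed.

End Insertion.

Lemma ins_entry0 t k G c : ins_entry t k G c 0 = t c 0.
Proof. by []. Qed.

Lemma yct_ins N t k M : yct N t -> k < N -> (forall c d, t c d != k) ->
  (forall c d, t c d < N -> (c.+1 < M) && (d.+1 < M)) ->
  yct N (ins_entry t k (grid M M)).
Proof.
move=> tY kN kt tM; split.
- by move=> c d; apply: leq_trans (ins_le _ _ _ _ _) (yct_le tY _ _).
- by move=> c d; apply: (ins_row tY).
- exact: (yct_col0 tY).
- by move=> i j d; apply: (ins_triple tY).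
- by move=> c d c' d'; apply: (ins_inj tY).
Qed.

(** * Adding a row with one cell *)

Definition row_added (t : nat -> nat -> nat) (N p x c d : nat) : nat :=
  if c < p then t c d else if c == p then (if d == 0 then x else N)
  else t c.-1 d.

(** As the lower row in the triple condition the new row has no second cell; as the upper one it
    gives the last hypothesis. *)
Lemma yct_row_added N t p x : yct N t -> x < N -> (forall c d, t c d != x) ->
  (forall i, i < p -> t i 0 < x) -> (forall i, p <= i -> x < t i 0) ->
  (forall i, t i 0 < x -> t i 1 < N -> t i 1 < x) ->
  yct N (row_added t N p x).
Proof.
move=> tY xN xt below above tx; rewrite /row_added; split.
- move=> c d; have := yct_le tY c d; have := yct_le tY c.-1 d.
  by do ?case: ifP; lia.
- move=> c d; have := yct_row tY c d; have := yct_row tY c.-1 d.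
  by do ?case: ifP => /=; lia.
- move=> i j ij; case: (ltngtP j p) => jp.
  + have -> : i < p by lia.
    by apply: (yct_col0 tY).
  + move=> tN; case: (ltngtP i p) => ip; last by apply: above; lia.
      by apply: ltn_trans (below _ ip) _; apply: above; lia.
    by apply: (yct_col0 tY) => //; lia.
  + have -> : i < p by lia.
    by move=> _; apply: below; lia.
- move=> i j d ij; case: (ltngtP j p) => jp.
  + have -> : i < p by lia.
    by apply: (yct_triple tY).
  + case: (ltngtP i p) => ip; last by rewrite ltnn.
      by apply: (yct_triple tY); lia.
    by apply: (yct_triple tY); lia.
  + have -> : i < p by lia.
    have ip : i < p by lia.
    case: d => [|d] /= tN.
      by have := tx _ (below _ ip) tN; lia.
    lia.
- move=> c d c' d'; have xt' i e : t i e = x -> False by move/eqP; apply/negP.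
  have tinj i e i' e' : t i e = t i' e' -> t i e < N -> i = i' /\ e = e'.
    by move=> h1 h2; case: (yct_inj tY h1 h2).
  case: (ltngtP c p) => cp; case: (ltngtP c' p) => cp';
    do ?[case: ifP => [/eqP ->|_]] => h hN;
    first [ by have := tinj _ _ _ _ h hN => -[e1 e2]; congr pair; lia
          | by case: (xt' _ _ h) | by case: (xt' _ _ (esym h))
          | by exfalso; lia | by rewrite cp cp' ].
Qed.

(** * The place of the new cell *)

Section Place.
Implicit Types c d i j e u x : nat.
Variables (N : nat) (t : nat -> nat -> nat).
Hypothesis tY : yct N t.
Variables (k M : nat).
Hypotheses (kN : k < N) (kt : forall c d, t c d != k).
Hypothesis tM : forall c d, t c d < N -> (c.+1 < M) && (d.+1 < M).
Local Notation G := (grid M M).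
Local Notation t' := (ins_entry t k G).
Local Notation kap := (kap t k M).
Local Notation final := (final t k M).

(* The new cell always ends the lowest row of its length; this is the case
   where the bottom row has that length. *)
Lemma new_cell_bottom r e : 0 < r -> t r e.+1 = N ->
  t r e <= kap r e -> kap r e < N ->
  t 0 e.+1 < N -> t 0 e.+2 = N -> False.
Proof.
move=> r0 trN h1 h2 v1 v2.
have Gr : (r, e) \in G by apply: (cell_grid tM); apply: leq_ltn_trans h1 h2.
have Gv : (0, e.+1) \in G by apply: (cell_grid tM).
have b : before (0, e.+1) (r, e) by rewrite /before /=; lia.
have hv : kap 0 e.+1 < t 0 e.+1.
  rewrite ltnNge; apply/negP => h; have := kap_before t k Gv Gr b.
  have h' : kap 0 e.+1 < t 0 e.+2.
    rewrite v2; apply: leq_ltn_trans h2; apply: kap_le => //.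
    by rewrite /before /=; lia.
  by rewrite pass_bump // v2 leqNgt h2.
case: (ltnP (kap r e) (t 0 e.+1)) => hr.
  have : t r e.+1 < t 0 e.+1 by apply: (yct_triple tY) => //; lia.
  by rewrite trN; lia.
have [|i [e' [b1 b2 j1 j2 /andP [j3 j4]]]] := kap_jump Gv Gr hv hr.
  by rewrite /before /=; lia.
have [[e1 r1]|[e1 r1]] : (e' = e.+1 /\ i = 0) \/ (e' = e /\ r < i).
  by move: b1 b2; rewrite /before /=; lia.
  by subst; lia.
subst e'; have : t i e.+1 < t 0 e.+1 by apply: (yct_triple tY) => //; lia.
lia.
Qed.

(** The position (0, 0) is the last of the path: a letter reaching it that is at least [t 0 0] would
    stop in the missing cell (0, 1), and a smaller one is not exchanged any more. *)
Lemma new_row_bottom : t 0 0 < N -> t 0 1 = N -> final < N -> final < t 0 0.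
Proof.
move=> h0 h1 fN; have G0 : (0, 0) \in G by apply: (cell_grid tM).
rewrite ltnNge; apply/negP => h.
have kf := leq_trans (leq_pass t (kap 0 0) (0, 0)) (kap_final t k G0).
case: (ltnP (kap 0 0) (t 0 0)) => h2; last first.
  have := kap_final t k G0; rewrite pass_bump ?h1 //; lia.
have [i [e [b1 j1 j2 j3 j4]]] := kap_jump_final G0 h2 h.
have [? ?] : e = 0 /\ i = 0 by move: b1; rewrite /before /=; lia.
subst; lia.
Qed.

(** After the earlier of two such positions the carried value is [N], against the bound on [kap] at
    the other. *)
Lemma unique_place c d c' d' : (c, d) \in G -> (c', d') \in G ->
  t c d <= kap c d -> kap c d < N -> t c d.+1 = N ->
  t c' d' <= kap c' d' -> kap c' d' < N -> t c' d'.+1 = N -> (c, d) = (c', d').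
Proof.
move=> Gp Gq a1 a2 a3 b1 b2 b3.
case: (boolP (before (c, d) (c', d'))) => [h|h1].
  by have := kap_before t k Gp Gq h; rewrite pass_bump ?a3 //; lia.
case: (boolP (before (c', d') (c, d))) => [h|h2].
  by have := kap_before t k Gq Gp h; rewrite pass_bump ?b3 //; lia.
by move: h1 h2; rewrite /before /= => h1 h2; congr pair; lia.
Qed.

(* Bumping lemma: if a smaller letter is inserted next, the letter carried
   stays smaller than during the first insertion. *)
Lemma carry_smaller k' u : k' < k -> carry t k G u < N ->
  carry t' k' G u < carry t k G u.
Proof.
move=> kk; elim: u => [|u IHu]; first by rewrite !carry0.
have pG := pairwise_grid M M.
case: (ltnP u (size G)) => uG; last first.
  by rewrite !(carry_oversize _ _ (leqW uG)) -!(carry_oversize _ _ uG).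
case E : (nth (0, 0) G u) => [c d].
have Gp : (c, d) \in G by rewrite -E mem_nth.
have iu : u = index (c, d) G by rewrite -E index_uniq // (uniq_before pG).
rewrite iu !carryS // -iu => h.
have {}IHu : carry t' k' G u < carry t k G u.
  by apply: IHu; apply: leq_ltn_trans h; apply: leq_pass.
have ek : carry t k G u = kap c d by rewrite iu.
rewrite ek in IHu h *; set x' := carry t' k' G u in IHu *.
case: (ins_spec t k M c d.+1) => [[e [[<-] _ a1 a2 E1]]|[E1 ne]].
  by rewrite (pass_bump a1 a2) passE E1; case: ifP; lia.
have -> : pass t (kap c d) (c, d) = kap c d.
  by rewrite passE; case: ifP => // /andP [a1 a2]; case: (ne d).
rewrite passE E1; case: ifP => // /andP [b1 b2].
case: (leqP (t c d) (kap c d)) => a1.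
  case: (ltnP (kap c d) (t c d.+1)) => a2; first by case: (ne d).
  (* Equality would mean that the first insertion had already picked this letter up at (c, d), whose
     turn has not come yet. *)
  rewrite ltn_neqAle a2 andbT; apply/eqP => e.
  have xN : t c d.+1 < N by rewrite e; apply: leq_ltn_trans h; apply: leq_pass.
  by have [_] := carry_eq tY kt (esym e) xN; rewrite ltnn.
(* If (c, d) was replaced, its new letter was carried later than [kap c d] and is at least as large,
   so the smaller letter [x'] cannot reach it. *)
case: (ins_spec t k M c d) b1 => [[e [ed Ge _ _ ->]]|[-> _]]; last lia.
have : kap c d <= kap c e by apply: kap_le => //; rewrite /before /= ed; lia.
lia.
Qed.

End Place.

(** * Insertion into tableaux given by their rows *)

Section Tableaux.
Variable N : nat.
Implicit Types (T : filling) (k c d : nat).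

(** The second clause excludes empty rows, whose [head 0] would be 0 instead of [N]. *)
Definition tableau T : Prop :=
  [/\ bounded N T, forall c, c < size T -> letter N T c 0 < N
    & yct N (letter N T)].

Definition fits M T : Prop :=
  forall c d, letter N T c d < N -> (c.+1 < M) && (d.+1 < M).

Lemma fits_large T : bounded N T -> exists M0, forall M, M0 <= M -> fits M T.
Proof.
move=> bT; exists (size T + foldr maxn 0 (shape T)).+2 => M hM c d.
rewrite letter_lt // => Tcd; have rT := cell_row Tcd.
have : size (trow T c) <= foldr maxn 0 (shape T).
  by apply: leq_trans (leq_foldr_maxn _ c); rewrite (nth_map [::]).
by move: Tcd; rewrite /is_cell; lia.
Qed.

Lemma insertP M T k : bounded N T -> k < N -> fits M T ->
  exists T1, [/\ size T1 = size T, bounded N T1,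
    forall c d, letter N T1 c d = ins_entry (letter N T) k (grid M M) c d &
    if final (letter N T) k M < N
    then insert k T = (add_row (final (letter N T) k M) T1, 0)
    else exists r e, [/\ (r, e) \in grid M M, letter N T r e.+1 = N,
           letter N T r e <= kap (letter N T) k M r e,
           kap (letter N T) k M r e < N & insert k T = (T1, e.+1)]].
Proof.
move=> bT kN tM; rewrite /insert (@scan_orderE _ M); last first.
  by move=> c d; rewrite -(@letter_lt N) // => /tM /andP [/ltnW -> /ltnW ->].
have [|T1 [s1 b1 l1]] := @insert_alongP N (fun p => is_cell T p.1 p.2)
  (grid M M) T k (pairwise_grid M M) bT kN; first by [].
rewrite -carry_size -/(final _ _ _) => res; exists T1; split=> //.
case: ifP res => // _ [[r e] /= [Gp tN /andP [/= b2 b3] ->]].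
by exists r, e; rewrite /= tN in b3 *.
Qed.

Lemma eq_yct t1 t2 : (forall c d, t1 c d = t2 c d) -> yct N t2 -> yct N t1.
Proof.
move=> E [h1 h2 h3 h4 h5]; split.
- by move=> c d; rewrite E.
- by move=> c d; rewrite !E.
- by move=> i j; rewrite !E; apply: h3.
- by move=> i j d; rewrite !E; apply: h4.
- by move=> c d c' d'; rewrite !E; apply: h5.
Qed.

Lemma head_letter T c : bounded N T -> letter N T c 0 < N ->
  head 0 (trow T c) = letter N T c 0.
Proof.
by move=> bT; rewrite letter_lt // => h; rewrite letter_entry.
Qed.

Lemma letter_add_row T x c d :
  letter N (add_row x T) c d =
  row_added (letter N T) N (find (fun r => x < head 0 r) T) x c d.
Proof.
set p := find _ T; have pT : p <= size T by apply: find_size.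
rewrite /letter /row_added /trow /add_row -/p nth_cat size_takel //.
case: (ltngtP c p) => [cp|cp|->]; first by rewrite nth_take.
  have -> : c - p = (c.-1 - p).+1 by lia.
  by rewrite /= nth_drop subnKC //; lia.
by rewrite subnn; case: d => //= d; rewrite nth_nil.
Qed.

Section AddRow.
Variables (T : filling) (x : nat).
Hypotheses (bT : bounded N T) (T0 : forall c, c < size T -> letter N T c 0 < N).
Hypotheses (colT : forall i j, i < j -> letter N T j 0 < N ->
  letter N T i 0 < letter N T j 0) (xN : x < N).
Hypothesis (xT : forall c d, letter N T c d != x).
Let p := find (fun r => x < head 0 r) T.

Lemma add_row_below i : i < p -> letter N T i 0 < x.
Proof.
move=> ip; have iT : i < size T by apply: leq_trans ip (find_size _ _).
have := before_find [::] ip; rewrite -/(trow T i) head_letter ?T0 //.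
by have := xT i 0; lia.
Qed.

Lemma add_row_above i : p <= i -> x < letter N T i 0.
Proof.
move=> ip; case: (ltnP i (size T)) => iT; last first.
  by rewrite /letter /trow (nth_default [::]) // nth_nil.
have hp : has (fun r => x < head 0 r) T by rewrite has_find (leq_ltn_trans ip).
have := nth_find [::] hp; rewrite -/p -/(trow T p) head_letter ?T0 //; last first.
  by apply: leq_ltn_trans iT.
move=> h; case: (ltngtP p i) ip => // [pi|<-//] _.
exact: ltn_trans h (colT pi (T0 iT)).
Qed.

Lemma bounded_add_row : bounded N (add_row x T).
Proof.
move: bT; rewrite /bounded /add_row -/p -{1}(cat_take_drop p T) !all_cat /=.
by move=> /andP [-> ->]; rewrite xN.
Qed.

Lemma size_add_row : size (add_row x T) = (size T).+1.
Proof. by rewrite /add_row size_cat /= addnS -size_cat cat_take_drop. Qed.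

End AddRow.

Lemma insert_tableau T k : tableau T -> k < N ->
    (forall c d, letter N T c d != k) ->
  tableau (insert k T).1 /\
  forall c d, letter N (insert k T).1 c d < N ->
    letter N (insert k T).1 c d = k \/
    exists i e, letter N (insert k T).1 c d = letter N T i e.
Proof.
move=> [bT T0 tY] kN kT; have [M0 /(_ M0 (leqnn _)) tM] := fits_large bT.
have [T1 [s1 b1 l1 res]] := insertP bT kN tM.
have tY1 : yct N (letter N T1) := eq_yct l1 (yct_ins tY kN kT tM).
have T10 c : c < size T1 -> letter N T1 c 0 < N.
  by rewrite s1 l1 ins_entry0; apply: T0.
have val1 c d : letter N T1 c d < N -> letter N T1 c d = k \/
    exists i e, letter N T1 c d = letter N T i e.
  by rewrite l1; apply: ins_val.
case: ifP res => fN; last by move=> [r [e [_ _ _ _ ->]]].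
move=> -> /=; set f := final _ _ _ in fN *.
have fT c d : letter N T1 c d != f.
  by apply/eqP; rewrite l1; apply: (final_fresh tY kN kT fN).
have below := add_row_below b1 T10 fN fT.
have above := add_row_above b1 T10 (yct_col0 tY1) fN.
have l2 := letter_add_row T1 f.
split.
  split; first exact: bounded_add_row.
    move=> c; rewrite size_add_row l2 /row_added ltnS => cT.
    case: (ltngtP c (find _ T1)) => // h; apply: T10; last lia.
    exact: leq_trans h (find_size _ _).
  apply: (eq_yct l2); apply: yct_row_added => // i.
  rewrite !l1 ins_entry0 => h1 h2; exact: (ins_new_row tY kN kT tM).
move=> c d; rewrite l2 /row_added; case: (ltngtP c (find _ T1)) => _; [exact: val1|exact: val1|].
case: eqP => _; last by rewrite ltnn.
by move=> _; apply: final_val fN.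
Qed.

Lemma eq_filling T T' : size T = size T' -> bounded N T -> bounded N T' ->
  (forall c d, letter N T c d = letter N T' c d) -> T = T'.
Proof.
move=> sT bT bT' e; apply: (eq_from_nth (x0 := [::])) => // c _.
exact: (eq_trow bT bT' (e c)).
Qed.

Lemma nth_shape T c : nth 0 (shape T) c = size (trow T c).
Proof.
case: (ltnP c (size T)) => cT; first by rewrite (nth_map [::]).
by rewrite /trow !nth_default ?size_map.
Qed.

(** The shape forces the new row to the bottom; its letter is then smaller than all letters of [T],
    so it is [k] itself and nothing was bumped. *)
Lemma insert_new_row T k beta : tableau T -> k < N ->
    (forall c d, letter N T c d != k) ->
    (insert k T).2 = 0 -> shape (insert k T).1 = 1 :: beta ->
  (forall c d, k < letter N T c d) /\ (insert k T).1 = [:: k] :: T.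
Proof.
move=> [bT T0 tY] kN kT; have [M0 /(_ M0 (leqnn _)) tM] := fits_large bT.
have [T1 [s1 b1 l1 res]] := insertP bT kN tM.
case: ifP res => fN; last by move=> [r [e [_ _ _ _ ->]]].
move=> -> /= _; set f := final _ _ _ in fN * => sh.
have tY1 : yct N (letter N T1) := eq_yct l1 (yct_ins tY kN kT tM).
have T10 c : c < size T1 -> letter N T1 c 0 < N.
  by rewrite s1 l1 ins_entry0; apply: T0.
have fT c d : letter N T1 c d != f.
  by apply/eqP; rewrite l1; apply: (final_fresh tY kN kT fN).
have below := add_row_below b1 T10 fN fT.
have above := add_row_above b1 T10 (yct_col0 tY1) fN.
have l2 := letter_add_row T1 f.
(* If the new row were higher, the bottom row would be an old row with one cell, and
   [new_row_bottom] would make [f] smaller than its letter. *)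
have p0 : find (fun r => f < head 0 r) T1 = 0.
  apply/eqP; rewrite eqn0Ngt; apply/negP => p0.
  have := below _ p0; rewrite l1 ins_entry0 ltnNge => /negP; apply.
  have h00 : letter N T 0 0 < N.
    by apply: T0; rewrite -s1; apply: leq_trans p0 (find_size _ _).
  apply/ltnW/(new_row_bottom tY kN tM) => //.
  have := nth_shape (add_row f T1) 0; rewrite sh /= => sz.
  have := l2 0 1; rewrite /row_added p0 l1 /letter nth_default -?sz // => e.
  by apply/eqP; rewrite eqn_leq (yct_le tY) {1}e; apply: ins_le.
have fall c d : f < letter N T c d.
  elim: d => [|d IHd]; last exact: leq_trans IHd (yct_row tY c d).
  by have := above c; rewrite p0 l1 ins_entry0; apply.
have fk : f = k.
  by case: (final_val fN) => // [[i [e h]]]; have := fall i e; rewrite -h ltnn.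
rewrite fk in fall *; split=> //.
have eT : T1 = T.
  apply: eq_filling => // c d; rewrite l1.
  case: (ins_spec (letter N T) k M0 c d) => [[e [_ _ h _ _]]|[-> //]].
  move: h; rewrite /kap carry_nobump //; last exact: pairwise_grid.
  by rewrite leqNgt fall.
by move: p0; rewrite eT fk /add_row => ->; rewrite take0 drop0.
Qed.

(** By [new_cell_bottom], the new cell cannot lie above a bottom row that already had length [d.+2],
    so it ends the bottom row itself. *)
Lemma insert_bottom M T k d beta : tableau T -> k < N ->
    (forall c e, letter N T c e != k) -> fits M T ->
    (insert k T).2 = d.+1 -> shape (insert k T).1 = d.+2 :: beta ->
  [/\ shape T = d.+1 :: beta, (0, d) \in grid M M,
      letter N T 0 d <= kap (letter N T) k M 0 d,
      kap (letter N T) k M 0 d < N &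
      letter N T 0 d.+1 = N /\ forall c e, letter N (insert k T).1 c e =
         ins_entry (letter N T) k (grid M M) c e].
Proof.
move=> [bT T0 tY] kN kT tM.
have [T1 [s1 b1 l1 res]] := insertP bT kN tM.
case: ifP res => fN; first by move=> ->.
move=> [r [e [Gr tN h1 h2 ->]]] /= [?] sh; subst e.
(* An exchange with an existing letter keeps the shape, and by [unique_place] only one missing cell
   is filled. *)
have cells c x : is_cell T1 c x = is_cell T c x || ((c, x) == (r, d.+1)).
  rewrite -!(@letter_lt N) // l1.
  case: (ins_spec (letter N T) k M c x) => [[y [? Gc a1 a2 ->]]|[-> ne]].
    subst x; have lN := yct_le tY c y.+1.
    rewrite (leq_trans a2 lN); case: (ltngtP (letter N T c y.+1) N) lN => // lN _.
    apply/esym/eqP; have aN := leq_trans a2 (yct_le tY c y.+1).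
    by case: (unique_place kN Gc Gr a1 aN lN h1 h2 tN) => -> ->.
  case: eqP => [[? ?]|]; last by rewrite orbF.
  by subst; case: (ne d); rewrite // tN.
have rsize : size (trow T r) = d.+1.
  apply/eqP; rewrite eqn_leq leqNgt -/(is_cell T r d.+1) -/(is_cell T r d).
  by rewrite -!(@letter_lt N) // tN ltnn (leq_ltn_trans h1 h2).
have sizes c : size (trow T1 c) = if c == r then d.+2 else size (trow T c).
  have H x : (x < size (trow T1 c)) =
      (x < size (trow T c)) || (c == r) && (x == d.+1) by apply: cells.
  case: eqP H => [->|_] /= H.
    by have := H (size (trow T1 r)); have := H d.+1; have := H d.+2;
       have := H d; rewrite rsize; lia.
  by have := H (size (trow T1 c)); have := H (size (trow T c)); lia.
have r0 : r = 0.
  apply/eqP; rewrite eqn0Ngt; apply/negP => r0.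
  have := sizes 0; rewrite -nth_shape sh /= eq_sym (gtn_eqF r0) => s0.
  apply: (new_cell_bottom tY kN tM r0 tN h1 h2).
    by rewrite letter_lt // /is_cell -s0.
  by rewrite /letter nth_default -?s0.
subst r; split=> //; apply: (eq_from_nth (x0 := 0)).
  by have := congr1 size sh; rewrite !size_map s1.
move=> c _; rewrite nth_shape; case: c => [|c] //.
by have := sizes c.+1; rewrite -!nth_shape sh /= => ->.
Qed.

(** If [k' < k], the second letter carried to the end of the bottom row is smaller than the letter
    just placed there and cannot stop after it: for a row of one cell nothing is bumped on the way,
    for a longer one this is [carry_smaller]. *)
Lemma insert_increasing T k k' d beta beta' : tableau T -> k < N -> k' < N ->
    (forall c e, letter N T c e != k) -> (forall c e, letter N T c e != k') ->
    k' != k ->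
    (insert k T).2 = d -> shape (insert k T).1 = d.+1 :: beta ->
    (insert k' (insert k T).1).2 = d.+1 ->
    shape (insert k' (insert k T).1).1 = d.+2 :: beta' ->
  k < k'.
Proof.
move=> TT kN kN' kT kT' kk' i1 sh1 i2 sh2; rewrite ltnNge leq_eqVlt (negbTE kk') /=.
apply/negP => lt_kk; have [TT' vals] := insert_tableau TT kN kT.
have kT1 c e : letter N (insert k T).1 c e != k'.
  apply/eqP => h; have := vals c e; rewrite h => /(_ kN') [/eqP|[i [j /eqP]]].
    by rewrite (negbTE kk').
  by rewrite eq_sym (negbTE (kT' _ _)).
have [bT _ _] := TT; have [bT' _ _] := TT'.
have [M1 M1P] := fits_large bT; have [M2 M2P] := fits_large bT'.
have tM := M1P (M1 + M2) (leq_addr _ _); have tM' := M2P (M1 + M2) (leq_addl _ _).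
have [_ G2 a1 a2 _] := insert_bottom TT' kN' kT1 tM' i2 sh2.
case: d i1 sh1 i2 sh2 G2 a1 a2 => [|d] i1 sh1 i2 sh2 G2 a1 a2.
  have [kall E] := insert_new_row TT kN kT i1 sh1.
  move: a1; rewrite E {1}/letter /= /kap carry_nobump; first lia.
    exact: pairwise_grid.
  case=> [[|e]|c e] //; rewrite /letter /trow /= ?nth_nil //.
  exact: ltn_trans lt_kk (kall c e).
have [_ G1 b1 b2 [b3 E]] := insert_bottom TT kN kT tM i1 sh1.
have [_ _ tY] := TT.
have le1 : kap (letter N T) k (M1 + M2) 0 d.+1 <= kap (letter N T) k (M1 + M2) 0 d.
  by apply: kap_le => //; rewrite /before /=; lia.
have := carry_smaller tY kN kT lt_kk (leq_ltn_trans le1 b2).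
rewrite -(eq_carry (t1 := letter N (insert k T).1)); last by move=> p _; rewrite !E.
move=> lt2; move: a1; rewrite E /kap.
case: (ins_spec (letter N T) k (M1 + M2) 0 d.+1) => [[? [[<-] _ _ _ ->]]|[_ ne]].
  by move: lt2 le1; rewrite /kap; lia.
by case: (ne d); rewrite ?b3.
Qed.

End Tableaux.

(** * The words of K_alpha *)

Lemma PQ_rcons w x :
  PQ (rcons w x) = PQ_step (PQ w) ((size w).+1, x).
Proof.
rewrite /PQ size_rcons -[(size w).+1]addn1 iotaD /= cats1.
by rewrite zip_rcons ?size_iota // foldl_rcons add1n addn1.
Qed.

Lemma P_hat_rcons w x : P_hat (rcons w x) = (insert x (P_hat w)).1.
Proof. by rewrite /P_hat PQ_rcons. Qed.

Lemma Q_hat_rcons w x : Q_hat (rcons w x) =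
  record_step (insert x (P_hat w)).2 (size w).+1 (Q_hat w).
Proof. by rewrite /Q_hat PQ_rcons. Qed.

Lemma mem_add_row k T r : r \in add_row k T -> r \in T \/ r = [:: k].
Proof.
rewrite /add_row mem_cat inE; case/or3P => [/mem_take|/eqP ->|/mem_drop]; by auto.
Qed.

Lemma mem_append_first c k Q r : r \in append_first c k Q ->
  r \in Q \/ exists r0, [/\ r0 \in Q, size r0 = c & r = rcons r0 k].
Proof.
elim: Q => //= r1 Q IHQ; case: eqP => s1; rewrite !inE.
  case/orP => [/eqP ->|->]; last by left; rewrite orbT.
  by right; exists r1; rewrite inE eqxx.
case/orP => [->|/IHQ [->|[r0 [h1 h2 h3]]]]; [by left|by left; rewrite orbT|].
by right; exists r0; rewrite inE h1 orbT.
Qed.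

Lemma mem_append_topmost c k Q r : r \in append_topmost c k Q ->
  r \in Q \/ exists r0, [/\ r0 \in Q, size r0 = c & r = rcons r0 k].
Proof.
rewrite mem_rev => /mem_append_first; rewrite mem_rev.
case=> [|[r0 [h ? ?]]]; [by left | right].
by exists r0; split=> //; rewrite -mem_rev.
Qed.

(** Steps are numbered from 0 here but from 1 in [Q_hat], whence the predecessors below. *)
Definition new_column w u := (insert (nth 0 w u) (P_hat (take u w))).2.

(** [record_step] writes the number of the step in the column of the new cell and never changes the
    column of an older entry. *)
Lemma Q_hat_column w r j : r \in Q_hat w -> j < size r ->
  0 < nth 0 r j <= size w /\ new_column w (nth 0 r j).-1 = j.
Proof.
elim/last_ind: w r j => [|w x IHw] r j; first by rewrite /Q_hat /PQ.
have old r0 : r0 \in Q_hat w -> j < size r0 ->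
    0 < nth 0 r0 j <= size (rcons w x) /\ new_column (rcons w x) (nth 0 r0 j).-1 = j.
  move=> Qr jr; have [/andP [h1 h2] E] := IHw r0 j Qr jr.
  rewrite h1 size_rcons (leqW h2); split=> //; rewrite -[RHS]E /new_column.
  rewrite nth_rcons; have -> : (nth 0 r0 j).-1 < size w by lia.
  by rewrite -cats1 takel_cat //; lia.
have new r0 : (insert x (P_hat w)).2 = size r0 -> j = size r0 ->
    0 < nth 0 (rcons r0 (size w).+1) j <= size (rcons w x) /\
    new_column (rcons w x) (nth 0 (rcons r0 (size w).+1) j).-1 = j.
  move=> e1 ->; rewrite nth_rcons ltnn eqxx size_rcons ltnSn; split=> //=.
  by rewrite /new_column nth_rcons ltnn eqxx -cats1 take_size_cat.
rewrite Q_hat_rcons /record_step; case: eqP => [c0|_].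
  case/mem_add_row => [|-> /=]; first exact: old.
  rewrite ltnS leqn0 => /eqP j0; apply: (new [::]) => //.
case/mem_append_topmost => [|[r0 [Qr0 s0 ->]]]; first exact: old.
rewrite size_rcons ltnS leq_eqVlt => /orP [/eqP js|js]; first exact: new.
by have := old r0 Qr0 js; rewrite nth_rcons js.
Qed.

Section Word.
Variables (N : nat) (w : seq nat).
Hypotheses (uw : uniq w) (wN : all (fun x => x < N) w).

Local Notation x := (nth 0 w).
Local Notation P u := (P_hat (take u w)).

Lemma P_hatS u : u < size w -> P u.+1 = (insert (x u) (P u)).1.
Proof. by move=> uw'; rewrite (take_nth 0) // P_hat_rcons. Qed.

Lemma P_hat_tableau u : u <= size w -> tableau N (P u) /\
  forall c d, letter N (P u) c d < N -> letter N (P u) c d \in take u w.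
Proof.
elim: u => [_|u IHu lt_u].
  rewrite take0 /P_hat /PQ /=; split; last first.
    by move=> c d; rewrite /letter /trow /= !nth_nil ltnn.
  have e c d : letter N [::] c d = N by rewrite /letter /trow !nth_nil.
  by split=> //; split=> [c d|c d|i j _|i j d _|c d c' d' _];
    rewrite !e // ltnn.
have [TP vals] := IHu (ltnW lt_u).
have xN : x u < N by have /allP := wN; apply; apply: mem_nth.
have fresh c d : letter N (P u) c d != x u.
  apply/eqP => e; have := vals c d; rewrite e => /(_ xN).
  by rewrite in_take ?mem_nth // index_uniq // ltnn.
rewrite P_hatS //; have [TP' vals'] := insert_tableau TP xN fresh.
split=> // c d lN; rewrite (take_nth 0) // mem_rcons inE.
case: (vals' c d lN) => [->|[i [e E]]]; first by rewrite eqxx.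
by rewrite E vals ?orbT // -E.
Qed.

Lemma x_lt u : u < size w -> x u < N.
Proof. by move=> h; have /allP := wN; apply; apply: mem_nth. Qed.

Lemma fresh u v : u <= v -> v < size w -> forall c d, letter N (P u) c d != x v.
Proof.
move=> uv vw c d; apply/eqP => e.
have [_ /(_ c d)] := P_hat_tableau (leq_trans uv (ltnW vw)).
rewrite e => /(_ (x_lt vw)).
by rewrite in_take ?mem_nth // index_uniq // ltnNge uv.
Qed.

(* Since [m] is the first part of the final shape, the last [m] new cells, in
   columns m-1, ..., 0, all belong to the bottom row. *)
Lemma last_block s m beta : size w = s + m -> 0 < m ->
    (forall j, j < m -> new_column w (s + j) = j) ->
    shape (P_hat w) = m :: beta ->
  [/\ shape (P s) = beta, sorted ltn (drop s w),
      forall c d, x s < letter N (P s) c d & letter N (P_hat w) 0 0 = x s].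
Proof.
move=> sw m0 cols sh.
have shj i : i < m -> shape (P (s + (m - i))) = m - i :: beta.
  elim: i => [_|i IHi im]; first by rewrite subn0 -sw take_size.
  have hs := IHi (ltnW im).
  have E : m - i = (m - i.+1).+1 by lia.
  have [j ej] : exists j, m - i.+1 = j.+1 by exists (m - i.+2); lia.
  move: hs; rewrite E ej addnS => hs.
  have jw : s + j.+1 < size w by lia.
  have [TP _] := P_hat_tableau (ltnW jw).
  have [bT _ _] := TP.
  have [M0 /(_ M0 (leqnn _)) tM] := fits_large bT.
  rewrite P_hatS // in hs.
  have c : (insert (x (s + j.+1)) (P (s + j.+1))).2 = j.+1 by apply: cols; lia.
  by case: (insert_bottom TP (x_lt jw) (fresh (leqnn _) jw) tM c hs).
have jb j : 0 < j <= m -> shape (P (s + j)) = j :: beta.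
  by move=> h; have := shj (m - j); rewrite subKn; last lia; apply; lia.
have sw' : s < size w by lia.
have [|TP _] := @P_hat_tableau s; first by lia.
have [xs PS] : (forall c d, x s < letter N (P s) c d) /\ P s.+1 = [:: x s] :: P s.
  rewrite P_hatS //; apply: (insert_new_row (beta := beta) TP (x_lt sw')).
  - exact: fresh.
  - by have := cols 0 m0; rewrite addn0.
  - by rewrite -P_hatS // -addn1 jb //; lia.
split=> //.
- by have := jb 1; rewrite addn1 PS => /(_ m0) [].
- apply/(sortedP 0) => j; rewrite size_drop => jm.
  rewrite !nth_drop addnS.
  have [|TPj _] := @P_hat_tableau (s + j); first by lia.
  have h1 : s + j < size w by lia.
  have h2 : (s + j).+1 < size w by lia.
  apply: (insert_increasing (d := j) (beta := beta) (beta' := beta) TPj).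
  + exact: x_lt.
  + exact: x_lt.
  + exact: fresh.
  + by apply: fresh.
  + by rewrite nth_uniq //; lia.
  + by apply: cols; lia.
  + by rewrite -P_hatS // -addnS jb //; lia.
  + by rewrite -P_hatS // -addnS; apply: cols; lia.
  + by rewrite -P_hatS // -P_hatS // -!addnS jb //; lia.
(* Further insertions that lengthen the bottom row leave column 0 unchanged. *)
have : forall j, j < m -> letter N (P (s + j.+1)) 0 0 = x s.
  elim=> [_|j IHj jm]; first by rewrite addn1 PS.
  rewrite addnS P_hatS; last by lia.
  have jw : s + j.+1 < size w by lia.
  have [|TPj _] := @P_hat_tableau (s + j.+1); first by lia.
  have [bT _ _] := TPj.
  have [M0 /(_ M0 (leqnn _)) tM] := fits_large bT.
  have [||_ _ _ _ [_ ->]] := insert_bottom (d := j) (beta := beta) TPj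
    (x_lt jw) (fresh (leqnn _) jw) tM.
  + by apply: cols.
  + by rewrite -P_hatS // -addnS jb //; lia.
  by rewrite ins_entry0 IHj // ltnW.
by case: m m0 sw {cols sh shj jb} => // m _ sw /(_ m (leqnn _)); rewrite -sw take_size.
Qed.

End Word.

(** Induction on [alpha]: the last block of the word is the bottom row, and [last_block] leaves the
    other rows to the shorter word. The last conclusion is carried along to compare the first
    letters of consecutive blocks. *)
Lemma word_blocks N alpha w : uniq w -> all (fun x => x < N) w ->
    all (fun a => 0 < a) alpha -> size w = sumn alpha ->
    shape (P_hat w) = alpha ->
    (forall b j, j < nth 0 (rev alpha) b ->
       new_column w (sumn (take b (rev alpha)) + j) = j) ->
  exists T : filling, [/\ w = flatten (rev T), shape T = alpha,
    rows_increase T, first_column_increases T &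
    alpha != [::] -> letter N (P_hat w) 0 0 = head 0 (head [::] T)].
Proof.
elim: alpha w => [|a alpha IHa] w uw wN /= apos sw sh cols.
  by exists [::]; rewrite (size0nil sw).
case/andP: apos => a0 apos; rewrite rev_cons in cols.
have sw' : size w = sumn alpha + a by rewrite sw addnC.
have sl : sumn alpha <= size w by rewrite sw' leq_addr.
have cols' j : j < a -> new_column w (sumn alpha + j) = j.
  (* In [rev (a :: alpha)] the part [a] comes last, with index [size alpha]. *)
  move=> ja; have := cols (size alpha) j.
  rewrite nth_rcons size_rev ltnn eqxx -cats1 -(size_rev alpha) take_size_cat //.
  by rewrite sumn_rev; apply.
have [sh' sb xall PE] := last_block uw wN sw' a0 cols' sh.
case: (IHa (take (sumn alpha) w)) => //.
- exact: take_uniq.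
- by apply/allP => x /mem_take; have /allP := wN; apply.
- by rewrite size_takel.
- move=> b j jb; have bb : b < size (rev alpha).
    by rewrite ltnNge; apply/negP => h; rewrite nth_default in jb.
  have := cols b j; rewrite nth_rcons bb -cats1 takel_cat ?(ltnW bb) //.
  move=> /(_ jb) E; rewrite -[RHS]E /new_column.
  have lt_s : sumn (take b (rev alpha)) + j < sumn alpha.
    rewrite -(sumn_rev alpha) -{2}(cat_take_drop b (rev alpha)) sumn_cat.
    by rewrite (drop_nth 0) //= ltn_add2l ltn_addr.
  by rewrite nth_take // take_takel // ltnW.
move=> T [wT shT rT cT hT]; exists (drop (sumn alpha) w :: T); split.
- by rewrite rev_cons flatten_rcons -wT cat_take_drop.
- by rewrite /= shT size_drop sw' addKn.
- by rewrite /= sb.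
- rewrite /first_column_increases /=.
  have hs : head 0 (drop (sumn alpha) w) = nth 0 w (sumn alpha).
    by rewrite -nth0 nth_drop addn0.
  case: T shT cT hT {wT rT} => [|r T] //= shT cT hT.
  move: cT; rewrite /first_column_increases /= => ->.
  by rewrite andbT hs -hT ?xall // -shT.
- by rewrite /= -nth0 nth_drop addn0.
Qed.

(** This is the surjectivity of [delta]: it makes the homomorphism unique and lets the action be
    checked on words [w_r T]. *)
Lemma mem_K_setP alpha w : all (fun a => 0 < a) alpha -> w \in K_set alpha ->
  exists2 T, T \in SIT alpha & w = w_r T.
Proof.
move=> apos; rewrite mem_filter => /andP [/andP [/eqP sh /eqP EQ]].
rewrite /perm_words mem_permutations => pw.
set v := rev w; have pv : perm_eq v (iota 1 (sumn alpha)) by rewrite perm_rev.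
have uv : uniq v by rewrite (perm_uniq pv) iota_uniq.
have sv : size v = sumn alpha by rewrite (perm_size pv) size_iota.
have vN : all (fun x => x < (sumn alpha).+1) v.
  by rewrite (perm_all _ pv); apply/allP => x; rewrite mem_iota; lia.
have [|T [wT shT rT cT _]] := word_blocks uv vN apos sv sh.
  move=> b j jb; set beta := rev alpha in jb EQ *.
  have sb : sumn beta = sumn alpha by rewrite sumn_rev.
  have bb : b < size beta.
    by rewrite ltnNge; apply/negP => h; rewrite nth_default in jb.
  have szT : shape (T_row beta) = beta by rewrite reshapeKl // size_iota.
  have rQ : trow (T_row beta) b \in Q_hat v.
    by rewrite EQ mem_nth // -(size_map size) -/(shape _) szT.
  have sr : j < size (trow (T_row beta) b) by rewrite -nth_shape szT.
  have [_] := Q_hat_column rQ sr.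
  (* The letters of [T_row] are consecutive and start at 1, so the step recorded in row [b] and
     column [j] has the number [sumn (take b beta) + j] when counted from 0. *)
  suff -> : nth 0 (trow (T_row beta) b) j = (sumn (take b beta) + j).+1 by [].
  have lt_s : sumn (take b beta) + j < sumn beta.
    rewrite -{2}(cat_take_drop b beta) sumn_cat (drop_nth 0) //= ltn_add2l.
    by rewrite ltn_addr.
  by rewrite /trow nth_reshape nth_take // nth_drop nth_iota // add1n.
exists T; last by rewrite -(revK w) -/v wT rev_flatten map_rev revK.
rewrite mem_filter rT cT /= mem_fillings shT eqxx /=.
apply: (perm_trans _ pv); rewrite wT; apply: perm_flatten.
by rewrite perm_sym perm_rev.
Qed.

(* When the columns increase, the second alternative of the triple condition is
   impossible. *)
Record increasing (T : filling) : Prop := Increasing {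
  inc_row : forall c d, is_cell T c d.+1 -> entry T c d < entry T c d.+1;
  inc_col : forall i j d, i < j -> is_cell T i d -> is_cell T j d ->
    entry T i d < entry T j d;
  inc_next : forall i j d, i < j -> is_cell T i d.+1 -> is_cell T j d ->
    entry T i d.+1 < entry T j d }.

Lemma is_cellW T c d e : d <= e -> is_cell T c e -> is_cell T c d.
Proof. exact: leq_ltn_trans. Qed.

Lemma inc_row_lt T c d e : rows_increase T -> d < e -> is_cell T c e ->
  entry T c d < entry T c e.
Proof.
move=> rT de Tce; have cT := cell_row Tce.
have sc : sorted ltn (trow T c) by have /allP := rT; apply; apply: mem_nth.
apply: (sorted_ltn_nth ltn_trans) => //; rewrite inE //.
exact: ltn_trans de Tce.
Qed.

Lemma inc_row_le T c d e : increasing T -> d <= e -> is_cell T c e ->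
  entry T c d <= entry T c e.
Proof.
move=> [rT _ _]; elim: e => [|e IHe]; first by rewrite leqn0 => /eqP ->.
rewrite leq_eqVlt ltnS => /orP [/eqP -> //|de] Te.
exact: leq_trans (IHe de (is_cellW (leqnSn e) Te)) (ltnW (rT _ _ Te)).
Qed.

(** The common form of [columns_increase] and [triple_condition]. *)
Lemma all_pairsP T (P : nat -> nat -> nat -> bool) :
  reflect (forall i j d, i < j -> is_cell T j d -> P j i d)
    (all (fun j => all (fun i => all (P j i)
      (iota 0 (size (trow T j)))) (iota 0 j)) (iota 0 (size T))).
Proof.
apply: (iffP allP) => [H i j d ij Tjd|H j].
  have := H j; rewrite mem_iota (cell_row Tjd) => /(_ isT) /allP /(_ i).
  by rewrite mem_iota ij => /(_ isT) /allP /(_ d); rewrite mem_iota; apply.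
rewrite mem_iota => jT; apply/allP => i; rewrite mem_iota => ij.
by apply/allP => d; rewrite mem_iota => jd; apply: H.
Qed.

Lemma mem_SYCT_C alpha T : all (fun a => 0 < a) alpha ->
  T \in SYCT_C alpha <-> T \in fillings alpha /\ increasing T.
Proof.
move=> apos; rewrite !mem_filter; split.
  move=> /andP [/all_pairsP cT /andP [/and3P [rT _ /all_pairsP tT] ->]].
  split=> //; split=> [c d|i j d ij Ti Tj|i j d ij Ti Tj].
  - exact: inc_row_lt.
  - by have := cT i j d ij Tj; rewrite Ti.
  - rewrite ltnNge; apply/negP => h.
    have := tT i j d ij Tj; rewrite Ti h /= => /andP [Tj1 h1].
    by have := cT i j d.+1 ij Tj1; rewrite Ti /= ltnNge ltnW.
move=> [TF [rT cT nT]]; have [/eqP shT _] := andP (etrans (esym (mem_fillings _ _)) TF).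
rewrite TF andbT; apply/and4P; split.
- by apply/all_pairsP => i j d ij Tj; apply/implyP => Ti; apply: cT.
- apply/(all_nthP [::]) => c cT'; apply/(sortedP 0) => d; exact: rT.
- apply/(sortedP 0) => c; rewrite size_map => cT'.
  have cell0 i : i < size T -> is_cell T i 0.
    move=> iT; rewrite /is_cell -nth_shape shT.
    by have /allP := apos; apply; rewrite -shT mem_nth ?size_map.
  rewrite !(nth_map [::]) //; last by apply: ltnW.
  by rewrite -!nth0; apply: cT; rewrite ?cell0 // ltnW.
- apply/all_pairsP => i j d ij Tj; apply/implyP => /andP [Ti].
  by rewrite leqNgt nT.
Qed.

(** * Inserting the rows of an increasing tableau *)

Lemma insert_along_skip L1 L2 y T :
  (forall p, p \in L1 -> y < entry T p.1 p.2) ->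
  insert_along (L1 ++ L2) y T = insert_along L2 y T.
Proof.
elim: L1 => //= [[c d] L1] IHL H.
have := H (c, d) (mem_head _ _) => /= h.
rewrite [entry T c d <= y]leqNgt h /= if_same IHL // => p L1p.
by apply: H; rewrite inE L1p orbT.
Qed.

Lemma mem_scan_order T p : (p \in scan_order T) = is_cell T p.1 p.2.
Proof.
rewrite mem_filter -/(grid _ _) mem_grid; case: (boolP (is_cell _ _ _)) => //= h.
rewrite (cell_row h) /=; apply: leq_trans h _; rewrite -nth_shape.
exact: leq_foldr_maxn.
Qed.

Lemma insert_small y T : (forall c d, is_cell T c d -> y < entry T c d) ->
  all (fun r => r != [::]) T -> insert y T = ([:: y] :: T, 0).
Proof.
move=> H nT; rewrite /insert -[scan_order T]cats0 insert_along_skip.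
  rewrite /= /add_row; have -> : find (fun r => y < head 0 r) T = 0.
    case: T H nT => //= r T H /andP [r0 _].
    by have := H 0 0; rewrite /is_cell /entry /= lt0n size_eq0 nth0 => ->.
  by rewrite take0 drop0.
by move=> p; rewrite mem_scan_order; apply: H.
Qed.

(** Before the last cell of [r] only cells of higher rows in columns at least [(size r).-1] are
    scanned, and their entries exceed [y]. *)
Lemma insert_bottom_row y r T : r != [::] -> last 0 r <= y ->
    (forall c d, is_cell T c d -> (size r).-1 <= d -> y < entry T c d) ->
  insert y (r :: T) = (rcons r y :: T, size r).
Proof.
move=> r0 ry H; set j := (size r).-1; set U := r :: T.
have sr : size r = j.+1 by rewrite /j prednK // lt0n size_eq0.
have Uj : is_cell U 0 j by rewrite /is_cell /= sr.
have Sj : (0, j) \in scan_order U by rewrite mem_scan_order.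
have pS : pairwise before (scan_order U) by apply/pairwise_filter/pairwise_grid.
have cS p : p \in scan_order U -> is_cell U p.1 p.2 by rewrite mem_scan_order.
rewrite /insert -/U; move: pS cS; case: (splitPr Sj) => S1 S2.
rewrite pairwise_cat => /and3P [/allrelP bS _ _] cS; rewrite insert_along_skip.
  rewrite /= /is_cell /= sr ltnn /= /entry /= -[j]/(j.+1.-1) -sr nth_last ry.
  by rewrite /set_entry /= set_nthE sr ltnn subnn /= cats1.
move=> [c d] Sp; have := bS _ (0, j) Sp (mem_head _ _).
have := cS (c, d); rewrite mem_cat Sp => /(_ isT).
case: c {Sp} => [|c]; rewrite /is_cell /before /=; first by rewrite sr; lia.
by move=> h1 h2; apply: (H c d h1); rewrite -/j; lia.
Qed.

Lemma append_topmost_rcons c k Q r : size r = c ->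
  append_topmost c k (rcons Q r) = rcons Q (rcons r k).
Proof.
by move=> sr; rewrite /append_topmost rev_rcons /= sr eqxx rev_cons revK.
Qed.

Lemma add_row_top k T : (forall r, r \in T -> head 0 r <= k) ->
  add_row k T = rcons T [:: k].
Proof.
move=> H; rewrite /add_row hasNfind; first by rewrite take_size drop_size cats1.
by apply/hasPn => r /H; rewrite leqNgt.
Qed.

Lemma T_row_rcons beta a :
  T_row (rcons beta a) = rcons (T_row beta) (iota (sumn beta).+1 a).
Proof.
rewrite /T_row sumn_rcons reshape_rcons ?size_iota // iotaD.
by rewrite take_size_cat ?drop_size_cat ?size_iota.
Qed.

(** Nothing is bumped: by [inc_col] the first letter of a row is smaller than all rows above and
    opens a new bottom row; by [inc_next] each further letter is smaller than whatever is scanned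
    before the end of that row. Meanwhile the topmost row of [Q_hat] is filled with consecutive
    numbers. *)
Lemma PQ_flatten_rev T : increasing T -> all (fun r => r != [::]) T ->
  PQ (flatten (rev T)) = (T, T_row (rev (shape T))).
Proof.
elim: T => [//|r T IHT] [rT cT nT] /= /andP [r0 T0].
have iT : increasing T.
  split=> [c d|i j d ij|i j d ij]; first exact: (rT c.+1 d).
    exact: (cT i.+1 j.+1 d).
  exact: (nT i.+1 j.+1 d).
have {}IHT := IHT iT T0.
rewrite !rev_cons flatten_rcons T_row_rcons sumn_rev.
set w := flatten (rev T) in IHT *; set s := sumn (shape T).
have sw : size w = s by rewrite size_flatten /shape map_rev sumn_rev.
(* Inner induction on the number [j] of letters of the bottom row already inserted. *)
suff: forall j, 0 < j <= size r -> PQ (w ++ take j r) =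
    (take j r :: T, rcons (T_row (rev (shape T))) (iota s.+1 j)).
  move=> /(_ (size r)); rewrite take_size; apply.
  by rewrite leqnn lt0n size_eq0 r0.
elim=> // j IHj /= jr; rewrite (take_nth 0) // -rcons_cat PQ_rcons.
rewrite size_cat size_takel ?(ltnW jr) // sw.
case: j IHj jr => [|j] IHj jr.
  rewrite take0 cats0 IHT /PQ_step /= addn0 insert_small //=.
    rewrite /record_step /= add_row_top // => q.
    case: q => [//|x q] Qq /=; apply/ltnW.
    have : x \in flatten (T_row (rev (shape T))).
      by apply/flattenP; exists (x :: q); rewrite ?mem_head.
    by rewrite reshapeKr ?size_iota // mem_iota sumn_rev; lia.
  move=> c d Tcd; apply: leq_trans (inc_row_le iT (leq0n d) Tcd).
  by apply: (cT 0 c.+1 0) => //; apply: is_cellW Tcd.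
rewrite IHj ?(ltnW jr) // /PQ_step /=.
have sj : size (take j.+1 r) = j.+1 by rewrite size_takel // ltnW.
rewrite insert_bottom_row; first last.
- move=> c d Tcd; rewrite sj /= => jd.
  apply: leq_trans (inc_row_le iT jd Tcd).
  by apply: (nT 0 c.+1 j) => //; apply: is_cellW Tcd.
- rewrite (take_nth 0) ?last_rcons; last exact: ltnW.
  exact/ltnW/(rT 0 j).
- by rewrite -size_eq0 sj.
have e : iota s.+1 j.+2 = rcons (iota s.+1 j.+1) (s + j.+1).+1.
  by rewrite -[j.+2]addn1 iotaD cats1 addSn.
rewrite /record_step sj /= append_topmost_rcons /= ?size_iota //.
by congr (_, rcons _ _); rewrite [RHS]e.
Qed.

Lemma rev_w_r T : rev (w_r T) = flatten (rev T).
Proof. by rewrite /w_r rev_flatten mapK //; apply: revK. Qed.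

Lemma SYCT_C_K_set alpha T : all (fun a => 0 < a) alpha ->
  T \in SYCT_C alpha -> w_r T \in K_set alpha.
Proof.
move=> apos /(mem_SYCT_C _ apos) [TF iT].
move: TF; rewrite mem_fillings => /andP [/eqP shT pT].
have T0 : all (fun r => r != [::]) T.
  apply/allP => r Tr; rewrite -size_eq0 -lt0n.
  by have /allP := apos; apply; rewrite -shT map_f.
rewrite mem_filter /P_hat /Q_hat rev_w_r PQ_flatten_rev //= shT !eqxx /=.
rewrite mem_permutations; apply: perm_trans pT.
rewrite -perm_rev rev_w_r; apply: perm_flatten.
by rewrite perm_rev.
Qed.

(** * Cells and positions in the reading word *)

Lemma entry_inj T c d c' d' : uniq (flatten T) ->
  is_cell T c d -> is_cell T c' d' -> entry T c d = entry T c' d' ->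
  c = c' /\ d = d'.
Proof.
elim: T c c' => [|r T IHT] c c' /=; first by rewrite /is_cell /trow nth_nil.
rewrite cat_uniq => /and3P [ur /hasPn rT uT].
have out e i j : is_cell T i j -> e < size r -> nth 0 r e != entry T i j.
  move=> Tij er; apply: contraTneq (mem_nth 0 er) => ->; apply: rT.
  apply/flattenP; exists (trow T i); last exact: mem_nth.
  by apply: mem_nth; apply: cell_row Tij.
case: c c' => [|c] [|c'] h h' /eqP e.
- by move: e; rewrite /entry nth_uniq // => /eqP.
- by have := out d c' d' h' h; rewrite (negPf (out d c' d' h' h)) in e.
- by rewrite eq_sym (negPf (out d' c d h h')) in e.
- by have [-> ->] := IHT c c' uT h h' (eqP e).
Qed.

Lemma row_colP x T : x \in flatten T ->
  is_cell T (row_of x T) (col_of x T) /\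
  entry T (row_of x T) (col_of x T) = x.
Proof.
move=> /flattenP [r Tr rx].
have hx : has (fun r => x \in r) T by apply/hasP; exists r.
have := nth_find [::] hx; rewrite -/(row_of x T) -/(trow T _) => h.
by rewrite /is_cell /entry /col_of index_mem h nth_index.
Qed.

(** Lower rows are read first, and each row from right to left. This turns [in_Des_L] into a
    comparison of cells. *)
Lemma index_w_r T x y c d c' d' : uniq (flatten T) ->
  is_cell T c d -> entry T c d = x -> is_cell T c' d' -> entry T c' d' = y ->
  (index y (w_r T) < index x (w_r T)) =
  (c' < c) || (c' == c) && (d < d').
Proof.
rewrite /w_r; elim: T c c' => [|r T IHT] c c' /=.
  by rewrite /is_cell /trow nth_nil.
move=> u; have := u; rewrite cat_uniq => /and3P [ur /hasPn rT uT].
have out i j : is_cell T i j -> entry T i j \notin rev r.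
  move=> Tij; rewrite mem_rev; apply: rT.
  apply/flattenP; exists (trow T i); last exact: mem_nth.
  by apply: mem_nth; apply: cell_row Tij.
have inr e : e < size r -> nth 0 r e \in rev r by rewrite mem_rev; apply: mem_nth.
have idx e : e < size r -> index (nth 0 r e) (rev r) = size r - e.+1.
  move=> er; have [k kr ->] : exists2 k, k < size r & e = size r - k.+1.
    by exists (size r - e.+1); lia.
  by rewrite -nth_rev // index_uniq ?rev_uniq ?size_rev //; lia.
case: c c' => [|c] [|c'] h ex h' ey; rewrite !index_cat.
- rewrite -ex -ey /entry /= !ifT ?inr // !idx //; move: h h'; rewrite /is_cell /=; lia.
- rewrite -ex -ey /entry /= ifN; last exact: out.
  rewrite ifT ?inr // idx // size_rev.
  by move: h h'; rewrite /is_cell /=; lia.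
- rewrite -ex -ey /entry /= ifT ?inr // ifN; last exact: out.
  by rewrite idx // size_rev; move: h h'; rewrite /is_cell /=; lia.
- rewrite !ifN; first by rewrite ltn_add2l (IHT c c').
    by rewrite -ex; apply: out.
  by rewrite -ey; apply: out.
Qed.

(** * Exchanging two consecutive letters *)

Lemma swap_letterK i : involutive (swap_letter i).
Proof. by move=> x; rewrite /swap_letter; do ?case: eqP => //; lia. Qed.

(** No letter lies strictly between [i] and [i.+1], so only this pair changes its order. *)
Lemma swap_letter_lt i x y : x < y -> ~~ ((x == i) && (y == i.+1)) ->
  swap_letter i x < swap_letter i y.
Proof. by rewrite /swap_letter; do ?case: eqP => //=; lia. Qed.

Lemma trow_s_fill i T c : trow (s_fill i T) c = s_word i (trow T c).
Proof.
case: (ltnP c (size T)) => cT; first by rewrite /trow (nth_map [::]).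
by rewrite /trow !nth_default ?size_map.
Qed.

Lemma is_cell_s_fill i T c d : is_cell (s_fill i T) c d = is_cell T c d.
Proof. by rewrite /is_cell trow_s_fill size_map. Qed.

Lemma entry_s_fill i T c d : is_cell T c d ->
  entry (s_fill i T) c d = swap_letter i (entry T c d).
Proof. by move=> h; rewrite /entry trow_s_fill (nth_map 0). Qed.

Lemma shape_s_fill i T : shape (s_fill i T) = shape T.
Proof.
by rewrite /shape /s_fill -map_comp; apply: eq_map => r /=; rewrite size_map.
Qed.

Lemma w_r_s_fill i T : s_word i (w_r T) = w_r (s_fill i T).
Proof.
rewrite /w_r /s_word /s_fill map_flatten -!map_comp; congr flatten.
by apply: eq_map => r /=; rewrite map_rev.
Qed.

Lemma s_fillK i : involutive (s_fill i).
Proof.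
move=> T; rewrite /s_fill -map_comp map_id_in // => r _ /=.
by rewrite /s_word (mapK (swap_letterK i)).
Qed.

(* [i] strictly above [i.+1] never lies in a cell which [increasing] requires
   to be smaller than that of [i.+1]. *)
Lemma increasing_s_fill i T c d c' d' : increasing T -> uniq (flatten T) ->
  is_cell T c d -> entry T c d = i.+1 -> is_cell T c' d' -> entry T c' d' = i ->
  c < c' -> increasing (s_fill i T).
Proof.
move=> [rT cT nT] uT h1 e1 h2 e2 cc.
have swp a b a' b' : a <= a' -> is_cell T a b -> is_cell T a' b' ->
    entry T a b < entry T a' b' ->
    entry (s_fill i T) a b < entry (s_fill i T) a' b'.
  move=> aa hab hab' lt; rewrite !entry_s_fill //; apply: swap_letter_lt => //.
  apply/negP => /andP [/eqP h /eqP h'].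
  have [? _] := entry_inj uT hab h2 (etrans h (esym e2)).
  have [? _] := entry_inj uT hab' h1 (etrans h' (esym e1)).
  lia.
split=> [a b|a a' b aa|a a' b aa]; rewrite !is_cell_s_fill.
- by move=> h; apply: swp => //; [apply: is_cellW h | apply: rT].
- by move=> h h'; apply: swp => //; [apply: ltnW | apply: cT].
- by move=> h h'; apply: swp => //; [apply: ltnW | apply: nT].
Qed.

(** * The map on basis elements and the two actions *)

Definition reading_tableau (alpha w : seq nat) : filling :=
  map rev (reshape alpha w).

Lemma w_rK T : reading_tableau (shape T) (w_r T) = T.
Proof.
rewrite /reading_tableau /w_r -[shape T](_ : shape (map rev T) = _).
  by rewrite flattenK mapK //; apply: revK.
by rewrite /shape -map_comp; apply: eq_map => r /=; rewrite size_rev.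
Qed.

Definition Upsilon_basis (alpha w : seq nat) : option filling :=
  let T := reading_tableau alpha w in if T \in SYCT_C alpha then Some T else None.

Lemma Upsilon_w_r alpha T : shape T = alpha -> Upsilon_basis alpha (w_r T) =
  if T \in SYCT_C alpha then Some T else None.
Proof. by move=> <-; rewrite /Upsilon_basis w_rK. Qed.

(** If [i] is weakly above [i.+1], both sides are the image of [w_r T]; otherwise both are
    [s_fill i T] if this lies in [SYCT_C alpha], and 0 if not. *)
Lemma Upsilon_act alpha i T : all (fun a => 0 < a) alpha ->
  0 < i < sumn alpha -> T \in SIT alpha -> 
  obind (Upsilon_basis alpha) (Y_act alpha i (w_r T)) =
  obind (S_act alpha i) (Upsilon_basis alpha (w_r T)).
Proof.
move=> apos /andP [i0 iN]; rewrite mem_filter => /andP [/andP [rT _] TF].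
have := TF; rewrite mem_fillings => /andP [/eqP shT pT].
have uT : uniq (flatten T) by rewrite (perm_uniq pT) iota_uniq.
have [|h1 e1] := @row_colP i T; first by rewrite (perm_mem pT) mem_iota; lia.
have [|h2 e2] := @row_colP i.+1 T; first by rewrite (perm_mem pT) mem_iota; lia.
have shs : shape (s_fill i T) = alpha by rewrite shape_s_fill.
rewrite (Upsilon_w_r shT) /Y_act /in_Des_L (index_w_r uT h1 e1 h2 e2) w_r_s_fill.
rewrite !(fun_if (obind _)) /= (Upsilon_w_r shT) (Upsilon_w_r shs).
rewrite {1}/S_act; set c := row_of i T in h1 e1 *; set d := col_of i T in h1 e1 *.
set c' := row_of i.+1 T in h2 e2 *; set d' := col_of i.+1 T in h2 e2 *.
(* Within one row [i] lies to the left of [i.+1], since rows increase. *)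
have Des : (c' < c) || (c' == c) && (d < d') = (c' <= c).
  case: ltngtP => //= cc; rewrite ltnNge; apply/negP; rewrite leq_eqVlt.
  rewrite cc in h2 e2; case/orP => [/eqP dd|dd].
    by rewrite dd e1 in e2; lia.
  by have := inc_row_lt rT dd h1; rewrite e1 e2; lia.
rewrite Des; case: (leqP c' c) => cc.
  case: (boolP (T \in _)) => //= TC; have [_ iT] := (mem_SYCT_C _ apos).1 TC.
  (* If [i.+1] were weakly left of [i], the entry in (c, d') would be at most [i] by its row and at
     least [i.+1] by its column. *)
  rewrite ifT // ltnNge; apply/negP => dd.
  have h : is_cell T c d' := is_cellW dd h1.
  have le1 := inc_row_le iT dd h1.
  move: cc; rewrite leq_eqVlt => /orP [/eqP cc|cc].
    by move: e2 le1; rewrite cc e1 => ->; lia.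
  by have := inc_col iT cc h2 h; lia.
(* The test for [K_set alpha] follows from that for [SYCT_C alpha] by [SYCT_C_K_set]. *)
have -> : (if w_r (s_fill i T) \in K_set alpha
     then if s_fill i T \in SYCT_C alpha then Some (s_fill i T) else None
     else None) = if s_fill i T \in SYCT_C alpha then Some (s_fill i T) else None.
  by case: (boolP (s_fill i T \in _)) => h; [rewrite SYCT_C_K_set | rewrite if_same].
have sTC_lt : s_fill i T \in SYCT_C alpha -> d' < d \/ d < d'.
  move=> /(mem_SYCT_C _ apos) [_ [_ sC _]].
  case: (ltngtP d d') => [|| dd]; [by right | by left | exfalso].
  rewrite dd in h1 e1; have := sC c c' d' cc; rewrite !is_cell_s_fill.
  move=> /(_ h1 h2); rewrite !entry_s_fill // e1 e2 /swap_letter eqxx.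
  by rewrite gtn_eqF // eqxx; lia.
case: (boolP (T \in _)) => TC /=.
  have [_ iT] := (mem_SYCT_C _ apos).1 TC.
  (* For [d < d'] the entry of (c', d) would lie strictly between [i] and [i.+1]. *)
  have dd : (d < d') = false.
    apply/negP => dd.
    have h : is_cell T c' d := is_cellW (ltnW dd) h2.
    have := inc_col iT cc h1 h; have := inc_row_lt rT dd h2.
    by rewrite e1 e2; lia.
  rewrite dd; case: (boolP (s_fill i T \in _)) => sTC; last by rewrite andbF.
  by case: (sTC_lt sTC) => [->//|]; rewrite dd.
(* In [s_fill i T] the letter [i] is above [i.+1], so exchanging back stays in [SYCT_C alpha]. *)
case: ifP => // sTC; case/negP: TC; apply/(mem_SYCT_C _ apos); split=> //.
have [sTF isT'] := (mem_SYCT_C _ apos).1 sTC.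
have us : uniq (flatten (s_fill i T)).
  move: sTF; rewrite mem_fillings => /andP [_ /perm_uniq ->].
  exact: iota_uniq.
rewrite -(s_fillK i T); apply: (increasing_s_fill isT' us) cc.
- by rewrite is_cell_s_fill; exact: h1.
- by rewrite entry_s_fill // e1 /swap_letter eqxx.
- by rewrite is_cell_s_fill; exact: h2.
- by rewrite entry_s_fill // e2 /swap_letter gtn_eqF // eqxx.
Qed.

Import GRing.Theory.
Local Open Scope ring_scope.

(** * Linear maps given on a basis *)

Section FreeModule.
Variables (C : fieldType) (A B : choiceType).

Lemma basis_vect0 (s : seq A) : basis_vect C s None = 0.
Proof. by apply/ffunP => y; rewrite !ffunE. Qed.

(** Composing maps described by option-valued functions amounts to [obind], which reduces identities
    of homomorphisms to basis elements. *)
Lemma lin_map_obasis (s : seq A) (t : seq B) (f : A -> option B)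
    (o : option A) : (forall x, o = Some x -> x \in s) ->
  lin_map C s t f (basis_vect C s o) = basis_vect C t (obind f o).
Proof.
case: o => [x|] H; first by rewrite lin_map_basis // H.
by rewrite !basis_vect0 linear0.
Qed.

Lemma free_hom_eq (s : seq A) (V : vectType C) (f g : 'Hom(free_on C s, V)) :
  (forall x, x \in s -> f (basis_vect C s (Some x)) = g (basis_vect C s (Some x))) ->
  f = g.
Proof.
move=> H; apply/lfunP => v.
have -> : v = \sum_(x : seq_sub s) v x *: basis_vect C s (Some (ssval x)).
  apply/ffunP => y; rewrite sum_ffunE (bigD1 y) //= big1 => [|z zy].
    by rewrite !ffunE eqxx addr0 /GRing.scale /= mulr1.
  rewrite !ffunE; case: eqP => [[e]|_]; last by rewrite scaler0.
  by case/eqP: zy; apply/val_inj.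
by rewrite !linear_sum; apply: eq_bigr => x _; rewrite !linearZ; congr (_ *: _);
  apply/H/valP.
Qed.

End FreeModule.

Theorem proposition5p3 (R : realType) (n : nat) (alpha : seq nat)
    (alpha_comp : is_composition n alpha) :
  exists! Upsilon : 'Hom(Y_mod R alpha, S_mod R alpha),
    is_H0_morphism n (@Y_pi R alpha) (@S_pi R alpha) Upsilon /\
    (Upsilon \o delta R alpha = eta_tilde R alpha \o Gamma R alpha)%VF.
Proof.
case/andP: alpha_comp => apos /eqP <-.
pose U : 'Hom(Y_mod R alpha, S_mod R alpha) := lin_map _ _ _ (Upsilon_basis alpha).
have deltaE T : T \in SIT alpha -> w_r T \in K_set alpha ->
    delta R alpha (basis_vect R[i] _ (Some T)) = basis_vect R[i] _ (Some (w_r T)).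
  by move=> TS TK; rewrite lin_map_basis // TK.
have UE : (U \o delta R alpha = eta_tilde R alpha \o Gamma R alpha)%VF.
  apply: free_hom_eq => T TS; rewrite !comp_lfunE !lin_map_basis //.
  have shT : shape T = alpha.
    by move: TS; rewrite mem_filter mem_fillings => /and3P [_ /eqP].
  rewrite !lin_map_obasis; last 2 first.
  - by move=> T'; case: ifP => // h [<-].
  - by move=> v; case: ifP => // h [<-].
  congr basis_vect; rewrite !(fun_if (obind _)) /= (Upsilon_w_r shT).
  case: (boolP (T \in SYCT_C alpha)) => TC; last by rewrite !if_same.
  (* For [T] in [SYCT_C alpha] both tests succeed: the word is in [K_set alpha], and [T] is in
     [SET alpha] since its rows and columns increase. *)
  rewrite SYCT_C_K_set // ifT // mem_filter.
  by move: TC TS; rewrite !mem_filter => /andP [-> _] /andP [/andP [-> _] ->].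
exists U; split.
  split=> //.
  move=> i i_n; apply: free_hom_eq => w Kw; rewrite !comp_lfunE.
  rewrite !lin_map_basis // !lin_map_obasis.
  + by have [T TS ->] := mem_K_setP apos Kw; rewrite Upsilon_act.
  + by move=> T; rewrite /Upsilon_basis; case: ifP => // h [<-].
  + by move=> v; rewrite /Y_act; case: ifP => [_ [<-] //|_]; case: ifP => // h [<-].
(* Each basis vector of [Y_mod] is the image under [delta] of one of [V_mod], so the equation
   prescribes the value of [U'] there. *)
move=> U' [_ U'E]; apply: free_hom_eq => w Kw.
have [T TS E] := mem_K_setP apos Kw; rewrite E in Kw *.
rewrite -deltaE // -!comp_lfunE U'E.
by rewrite -UE.
Qed.
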